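(* Let $F$ be an algebraically closed field of characteristic $0$, $n\ge 2$, $G=\mathbb{Z}_2^n$ with standard basis $e_1,\dots,e_n$, and let $\beta:G\times G\to F^\times$ be the alternating bicharacter with $\beta(e_i,e_i)=1$ and $\beta(e_i,e_j)=-1$ for $i\ne j$, i.e. $\beta(a,b)=(-1)^{(\sum_{i=1}^n a_i)(\sum_{i=1}^n b_i)-\sum_{i=1}^n a_ib_i}$. (1) $R^+=\{0,e_i\mid 1\le i\le n\}$ is a skew root system of Jordan type in $(G,\beta)$, which is reduced if and only if $n$ is even. The algebra $J(R^+)$ is isomorphic to the simple Jordan algebra of a nonsingular symmetric form, i.e. to $F\cdot 1\oplus V$ where $V$ is an $n$-dimensional vector space over $F$ with a nonsingular symmetric bilinear form. (2) Let $R^-=\{e_i+e_j\mid 1\le i<j\le n\}$ and let $G_1\cong\mathbb{Z}_2^{n-1}$ be the subgroup of $G$ generated by $R^-$. Assume $n\ge 3$. Then $(G_1,\beta|_{G_1},R^-)$ is a skew root system of Lie type. It is always indecomposable, and is reduced if and only if $n$ is odd. The algebra $L(R^-)$ is isomorphic to the Lie algebra $\mathfrak{so}_n(F)$, which is simple if and only if $n\ge 3$ and $n\ne 4$.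
   Context: An alternating bicharacter on an abelian group $G$ is a $\mathbb{Z}$-bilinear map $\beta:G\times G\to F^\times$ with $\beta(g,g)=1$ for all $g$; $\mathrm{Rad}(\beta)=\{g\in G:\beta(g,h)=1\ \forall h\in G\}$. Subsets $A,B\subseteq G$ are orthogonal if $\beta(a,b)=1$ for all $a\in A,b\in B$. $R\subseteq G$ is a skew root system of Lie type in $(G,\beta)$ if $\mathrm{Rad}(\beta)\ne G$ and: $R\subseteq G\setminus\mathrm{Rad}(\beta)$ generates $G$; $R=-R$; and $a,b\in R$, $\beta(a,b)\ne1$ imply $a+b\in R$. $R\subseteq G$ (nonempty) is a skew root system of Jordan type in $(G,\beta)$ if: $R$ generates $G$; $R=-R$; and $a,b\in R$, $\beta(a,b)\neq-1$ imply $a+b\in R$. Either is reduced if $\mathrm{Rad}(\beta)=0$. A skew root system of Lie type is decomposable if $G$ is the orthogonal direct sum of two proper subgroups $H_1,H_2$, $R$ is the union of two orthogonal subsets $R_1,R_2$, and $R_i$ is a skew root system of Lie type in $(H_i,\beta|_{H_i\times H_i})$ for $i=1,2$; otherwise indecomposable. Choose a 2-cocycle $\xi\in Z^2(G,F^\times)$ with $\xi(a,b)\xi(b,a)^{-1}=\beta(a,b)$ (it exists; different choices give isomorphic graded algebras), and let $F^\xi G$ be the associative algebra with basis $\{u_g:g\in G\}$ and $u_au_b=\xi(a,b)u_{a+b}$. For $R$ of Lie type, $L(R)=\bigoplus_{a\in R}Fu_a$ with $[x,y]=xy-yx$; for $R$ of Jordan type, $J(R)=\bigoplus_{a\in R}Fu_a$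 with $x\circ y=\frac12(xy+yx)$. The Jordan algebra of a nonsingular symmetric bilinear form $f$ on $V$ is $F\cdot1\oplus V$ with unit $1$ and $v\circ w=f(v,w)1$ for $v,w\in V$; it is the Jordan subalgebra $F\cdot 1\oplus V$ of $C(V)^+$ where $C(V)$ is the Clifford algebra. *)

(* Defs.v *)
From HB Require Import structures.
#[warnings="-notation-overridden,-ambiguous-paths"]
From mathcomp Require Import all_boot all_order all_fingroup all_algebra.

Set Implicit Arguments.
Unset Strict Implicit.
Unset Printing Implicit Defensive.

Import GRing.Theory.
Local Open Scope ring_scope.

Section SkewRootSystems.

(* A finite abelian group in additive notation.  A [finZmodType] is also a
   [finGroupType] whose product [( * )%g] is [+], so {group U}, <<R>>%g and
   [\x] below denote subgroups, generated subgroups and direct sums.  All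
   notions are relative to a subgroup [G] of [U]: only the values of [beta]
   on [G] matter, so [beta] also stands for its restrictions. *)
Variables (F : fieldType) (U : finZmodType).
Implicit Types (beta : U -> U -> F) (G H : {group U}) (R : {set U}).

Definition alternating_bicharacter G beta : Prop :=
  [/\ {in G &, forall a b, beta a b != 0},
      {in G & &, forall a b c, beta (a + b) c = beta a c * beta b c},
      {in G & &, forall a b c, beta a (b + c) = beta a b * beta a c}
    & {in G, forall a, beta a a = 1}].

Definition Rad G beta : {set U} := [set g in G | [forall h in G, beta g h == 1]].

Definition reduced G beta : Prop := Rad G beta = [set 0].

Definition orthogonal_sets beta (A B : {set U}) : Prop :=
  {in A & B, forall a b, beta a b = 1}.

Definition srs_Lie G beta R : Prop :=
  alternating_bicharacter G beta /\ Rad G beta <> G /\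
  [/\ R \subset G :\: Rad G beta, <<R>>%g = G,
      R = [set - a | a in R]
    & {in R &, forall a b, beta a b <> 1 -> a + b \in R}].

Definition srs_Jordan G beta R : Prop :=
  alternating_bicharacter G beta /\ R <> set0 /\
  [/\ <<R>>%g = G,
      R = [set - a | a in R]
    & {in R &, forall a b, beta a b <> -1 -> a + b \in R}].

Definition decomposable G beta R : Prop :=
  exists H1 H2 : {group U}, exists R1 R2 : {set U},
  [/\ H1 \proper G /\ H2 \proper G,
      (H1 \x H2)%g = G /\ orthogonal_sets beta H1 H2,
      R = R1 :|: R2 /\ orthogonal_sets beta R1 R2
    & srs_Lie H1 beta R1 /\ srs_Lie H2 beta R2].

Definition indecomposable G beta R : Prop := ~ decomposable G beta R.

Definition cocycle_for G beta (xi : U -> U -> F) : Prop :=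
  [/\ {in G &, forall a b, xi a b != 0},
      {in G & &, forall a b c,
         xi a b * xi (a + b) c = xi b c * xi a (b + c)}
    & {in G &, forall a b, xi a b / xi b a = beta a b}].

(* F^xi G is realized on the vectors of {ffun U -> F^o} supported in [G]; its
   product is the bilinear extension of u_a u_b = xi(a,b) u_(a+b). *)
Definition basis_elt (g : U) : {ffun U -> F^o} := [ffun x => (x == g)%:R].

Definition twisted_mul G xi (x y : {ffun U -> F^o}) : {ffun U -> F^o} :=
  \sum_(a in G) \sum_(b in G) (x a * y b * xi a b) *: basis_elt (a + b).

Lemma twisted_mul_basis G xi : {in G &, forall a b,
  twisted_mul G xi (basis_elt a) (basis_elt b) = xi a b *: basis_elt (a + b)}.
Proof.
move=> a b Ga Gb; rewrite /twisted_mul (bigD1 a) //= [X in _ + X]big1 => [|c].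
  rewrite addr0 (bigD1 b) //= big1 => [|d /andP[_ /negPf d_b]].
    by rewrite !ffunE !eqxx !mul1r addr0.
  by rewrite [basis_elt b d]ffunE d_b mulr0 mul0r scale0r.
case/andP=> _ /negPf c_a; rewrite big1 // => d _.
by rewrite [basis_elt a c]ffunE c_a !mul0r scale0r.
Qed.

Definition graded_space R : {vspace {ffun U -> F^o}} :=
  <<[seq basis_elt a | a in R]>>%VS.

Definition Lie_mul G xi (x y : {ffun U -> F^o}) : {ffun U -> F^o} :=
  twisted_mul G xi x y - twisted_mul G xi y x.

Definition Jordan_mul G xi (x y : {ffun U -> F^o}) : {ffun U -> F^o} :=
  2^-1 *: (twisted_mul G xi x y + twisted_mul G xi y x).

End SkewRootSystems.

Section Algebras.

(* A (non-associative) algebra is a subspace of a vector space [A] together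
   with an operation on [A] under which it is closed. *)
Variable F : fieldType.

Definition closed_under (A : vectType F) (m : A -> A -> A) (S : {vspace A}) :=
  {in S &, forall x y, m x y \in S}.

Definition isomorphic_algebras (A B : vectType F)
    (m : A -> A -> A) (S : {vspace A}) (m' : B -> B -> B) (T : {vspace B}) :=
  [/\ closed_under m S, closed_under m' T
    & exists phi : 'Hom(A, B),
      [/\ {in S &, injective phi}, (phi @: S)%VS = T
        & {in S &, forall x y, phi (m x y) = m' (phi x) (phi y)}]].

Definition ideal (A : vectType F) (m : A -> A -> A) (S I : {vspace A}) :=
  (I <= S)%VS /\ {in S & I, forall x y, m x y \in I /\ m y x \in I}.

Definition simple_algebra (A : vectType F) (m : A -> A -> A) (S : {vspace A}) :=
  [/\ closed_under m S, exists x y, [/\ x \in S, y \in S & m x y <> 0]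
    & forall I, ideal m S I -> I = 0%VS \/ I = S].

Definition mx_bracket (n : nat) (A B : 'M[F]_n) : 'M[F]_n := A *m B - B *m A.

(* The skew-symmetric matrices; see [mem_so]. *)
Definition so (n : nat) : {vspace 'M[F]_n} := lker (linfun trmx + \1)%VF.

Lemma mem_so n (A : 'M[F]_n) : (A \in so n) = (A^T == - A).
Proof. by rewrite memv_ker add_lfunE id_lfunE lfunE /= addr_eq0. Qed.

(* The pair (a, v) stands for a 1 + v in F 1 (+) V. *)
Definition form_mul (V : vectType F) (f : V -> V -> F) (x y : F^o * V) : F^o * V :=
  (x.1 * y.1 + f x.2 y.2, x.1 *: y.2 + y.1 *: x.2).

End Algebras.

Section Example.

Variable n : nat.

Definition e (i : 'I_n) : 'rV['Z_2]_n := delta_mx 0 i.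

Definition beta (F : fieldType) (a b : 'rV['Z_2]_n) : F :=
  (-1) ^+ ((\sum_i a 0 i) * (\sum_i b 0 i) - \sum_i a 0 i * b 0 i)%R.

Definition Rplus : {set 'rV['Z_2]_n} := 0 |: [set e i | i : 'I_n].

Definition Rminus : {set 'rV['Z_2]_n} :=
  [set e p.1 + e p.2 | p : 'I_n * 'I_n & (p.1 < p.2)%N].

Definition G1 : {group 'rV['Z_2]_n} := <<Rminus>>%G.

(* Cocycles exist, so that quantifying over all of them is not vacuous. *)
Lemma cocycle_beta (F : fieldType) (G : {group 'rV['Z_2]_n}) :
  exists xi, cocycle_for G (@beta F) xi.
Proof.
pose s (x : 'Z_2) : F := (-1) ^+ x.
have sD x y : s (x + y) = s x * s y.
  by case: x => [[|[|]]] //= ?; case: y => [[|[|]]] //= ?; rewrite /s /= ?expr1 ?expr0 ?mulr1 ?mul1r ?mulrNN ?mulr1.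
have s0 x : s x != 0 by rewrite signr_eq0.
have sN x : s (- x) = s x.
  by case: x => [[|[|]]].
pose q (a b : 'rV['Z_2]_n) := \sum_(i < n) \sum_(j < n | (i < j)%N) a 0 i * b 0 j.
have qDl a b c : q (a + b) c = q a c + q b c.
  rewrite /q -big_split; apply: eq_bigr => i _; rewrite -big_split.
  by apply: eq_bigr => j _; rewrite mxE mulrDl.
have qDr a b c : q a (b + c) = q a b + q a c.
  rewrite /q -big_split; apply: eq_bigr => i _; rewrite -big_split.
  by apply: eq_bigr => j _; rewrite mxE mulrDr.
exists (fun a b => s (q a b)); split=> [a b _ _|a b c _ _ _|a b _ _] //.
  by rewrite -!sD qDl qDr addrA [q b c + _]addrC.
apply: (canLR (mulfK (s0 _))).
rewrite /beta -[(-1) ^+ _]/(s _) -sD; congr s.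
have -> : (\sum_i a 0 i) * (\sum_i b 0 i) =
    q a b + q b a + \sum_i a 0 i * b 0 i.
  have -> : q b a = \sum_(i < n) \sum_(j < n | (j < i)%N) a 0 i * b 0 j.
    rewrite /q (exchange_big_dep predT) //=; apply: eq_bigr => i _.
    by apply: eq_bigr => j _; rewrite mulrC.
  rewrite mulr_suml /q -!big_split /=; apply: eq_bigr => i _.
  rewrite mulr_sumr (bigID (fun j : 'I_n => (i < j)%N)) /= -addrA.
  congr (_ + _); rewrite (bigD1 i) ?ltnn //= addrC; congr (_ + _).
  by apply: eq_bigl => j; rewrite -leqNgt ltn_neqAle andbC.
rewrite addrK -addrA; have -> : q b a + q b a = 0; last by rewrite addr0.
by case: (q b a) => [[|[|]]] //= ?; apply: val_inj.
Qed.

End Example.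

(* Main.v *)
Require Import Defs.
From HB Require Import structures.
From mathcomp Require Import all_boot all_order all_fingroup all_algebra.
From mathcomp Require Import ring.

(** The sign [beta a b] is [(-1) ^+ pairing a b], where [pairing] is a
    symmetric alternating bilinear form on [Z_2^n] with values in [Z_2] and
    value [1] on pairs of distinct basis vectors.  All statements about the
    root systems are computations with this form.  Call the vectors
    [e i + e j], [i != j], edges: they are the edges of the complete graph on
    the [n] indices, and the pairing of two edges is the parity of the number
    of indices that they share.  Hence two edges fail to commute exactly when
    they share one index, and their sum is then the third side of a triangle.
    The subgroup [G1 n] consists of the vectors of even weight ([mem_G1]);
    both radicals consist of constant vectors, and whether the nonzero
    constant vector belongs to them is a matter of the parity of [n].
    Indecomposability holds because any two edges are linked by a chain of
    consecutive non-commuting edges ([Rminus_connected]).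

    Jordan algebra.  The element [u_0] is a multiple of the unit,
    [u_(e i)^2] is a nonzero multiple of [u_0], and [u_(e i)], [u_(e j)]
    anticommute for [i != j], so that their Jordan product vanishes.  This is
    the multiplication table of the algebra of a diagonal form with nonzero
    coefficients ([Jordan_isomorphism]).  In dimension at least two a nonzero
    ideal of such an algebra contains a nonzero vector, hence the unit by
    nondegeneracy ([form_algebra_simple]).

    Lie algebra.  The bracket of the basis vectors of two edges [ij], [jk] is
    [2 xi(ij, jk) u_ik], and the matrices
    [M i j = E_ij - E_ji] ([rotation_gen]) satisfy [[M i j, M j k] = M i k]; brackets of commuting edges vanish on both
    sides.  So [u_(e i + e j) |-> t i j *: M i j] is an isomorphism onto
    [so F n] as soon as the scalars satisfy [t j i = - t i j] and
    [t i j * t j k = 2 xi(ij, jk) * t i k].  Such scalars exist for every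
    cocycle: those of the edges at one chosen index are square roots
    prescribed by the cocycle, and they determine the others
    ([structure_scalars]).

    Simplicity of [so F n].  The operator [- (ad M i j)^2] erases the entries
    of a skew-symmetric matrix whose position does not meet [{i, j}] in
    exactly one index.  With these erasures an ideal isolates [M p q] from any
    element with a nonzero entry at [(p, q)], unless [n = 4], where the
    complementary entry cannot be erased ([rotation_in_ideal]); brackets then
    yield the other [M k l].  For [n = 4] the self-dual matrices form an ideal,
    and for [n = 2] all brackets vanish. *)

Set Implicit Arguments.
Unset Strict Implicit.
Unset Printing Implicit Defensive.

Import GRing.Theory.
Local Open Scope ring_scope.

(** * The bicharacter as a form over the two-element field *)

Section Pairing.

Variable n : nat.
Implicit Types (a b c : 'rV['Z_2]_n) (i j k l p q s : 'I_n).

Lemma Z2_cases (x : 'Z_2) : x = 0 \/ x = 1.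
Proof. by case: x => [[|[|]]] //= ?; [left | right]; apply: val_inj. Qed.

Lemma addZ2xx (x : 'Z_2) : x + x = 0.
Proof. by case: (Z2_cases x) => ->; apply: val_inj. Qed.

Lemma oppZ2 (x : 'Z_2) : - x = x.
Proof. exact: addr0_eq (addZ2xx x). Qed.

Lemma mulZ2xx (x : 'Z_2) : x * x = x.
Proof. by case: (Z2_cases x) => ->; apply: val_inj. Qed.

Lemma addZ2v a : a + a = 0.
Proof. by apply/rowP => i; rewrite !mxE addZ2xx. Qed.

Lemma oppZ2v a : - a = a.
Proof. by apply/rowP => i; rewrite !mxE oppZ2. Qed.

Lemma addZ2vK a b : a + b + b = a.
Proof. by rewrite -addrA addZ2v addr0. Qed.

Definition wt a : 'Z_2 := \sum_i a 0 i.

(** The exponent in [beta], so that signs become sums in ['Z_2]. *)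
Definition pairing a b : 'Z_2 := wt a * wt b - \sum_i a 0 i * b 0 i.

Lemma wtD a b : wt (a + b) = wt a + wt b.
Proof. by rewrite /wt -big_split; apply: eq_bigr => i _; rewrite mxE. Qed.

Lemma wt0 : wt 0 = 0.
Proof. by rewrite /wt big1 // => i _; rewrite mxE. Qed.

Lemma eE i j : (e i : 'rV['Z_2]_n) 0 j = (j == i)%:R.
Proof. by rewrite mxE eqxx. Qed.

Lemma wt_e i : wt (e i) = 1.
Proof.
rewrite /wt (bigD1 i) //= eE eqxx big1 ?addr0 // => j /negPf ji.
by rewrite eE ji.
Qed.

Lemma pairingC a b : pairing a b = pairing b a.
Proof.
by rewrite /pairing mulrC; congr (_ - _); apply: eq_bigr => i _; rewrite mulrC.
Qed.

Lemma pairingDl a b c : pairing (a + b) c = pairing a c + pairing b c.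
Proof.
rewrite /pairing wtD mulrDl addrACA -opprD -big_split; congr (_ - _).
by apply: eq_bigr => i _; rewrite mxE mulrDl.
Qed.

Lemma pairingDr a b c : pairing a (b + c) = pairing a b + pairing a c.
Proof. by rewrite -!(pairingC _ a) pairingDl. Qed.

Lemma pairing_xx a : pairing a a = 0.
Proof.
rewrite /pairing mulZ2xx; apply/eqP; rewrite subr_eq0; apply/eqP.
by apply: eq_bigr => i _; rewrite mulZ2xx.
Qed.

Lemma pairing_er a i : pairing a (e i) = wt a - a 0 i.
Proof.
rewrite /pairing wt_e mulr1 (bigD1 i) //= eE eqxx mulr1 big1 ?addr0 // => j.
by rewrite eE => /negPf ->; rewrite mulr0.
Qed.

Lemma pairing_ee i j : pairing (e i) (e j) = (i != j)%:R.
Proof.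
rewrite pairing_er wt_e eE (eq_sym j).
by case: (i == j); rewrite ?subrr ?subr0.
Qed.

(** No step for scalar multiples: the only scalars are [0] and [1]. *)
Lemma basis_ind (P : 'rV['Z_2]_n -> Prop) :
  P 0 -> (forall a b, P a -> P b -> P (a + b)) -> (forall i, P (e i)) ->
  forall a, P a.
Proof.
move=> P0 PD Pe a; rewrite [a]row_sum_delta; apply: big_ind => // i _.
by case: (Z2_cases (a 0 i)) => ->; rewrite ?scale0r ?scale1r //; apply: Pe.
Qed.

Lemma e_neq0 i : e i != 0 :> 'rV['Z_2]_n.
Proof. by apply/eqP => /rowP/(_ i); rewrite eE eqxx mxE. Qed.

Lemma e_inj : injective (@e n).
Proof. by move=> i j /rowP/(_ i); rewrite !eE eqxx; case: eqP. Qed.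

Variable F : fieldType.

Definition sgn (x : 'Z_2) : F := (-1) ^+ x.

Lemma betaE a b : beta F a b = sgn (pairing a b).
Proof. by []. Qed.

Lemma sgnD (x y : 'Z_2) : sgn (x + y) = sgn x * sgn y.
Proof.
by case: (Z2_cases x) => ->; case: (Z2_cases y) => ->;
  rewrite /sgn /= ?expr0 ?expr1 ?mulr1 ?mul1r ?mulrNN ?mulr1.
Qed.

Lemma beta_alternating G : alternating_bicharacter G (@beta n F).
Proof.
split=> [a b _ _|a b c _ _ _|a b c _ _ _|a _]; rewrite !betaE.
- by rewrite signr_eq0.
- by rewrite pairingDl sgnD.
- by rewrite pairingDr sgnD.
- by rewrite pairing_xx.
Qed.

Lemma beta_ee i j : beta F (e i) (e j) = (-1) ^+ (i != j).
Proof. by rewrite betaE pairing_ee; case: (i != j). Qed.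

(** Induction in each variable; the value at [0] is forced to be [1] because it
    is nonzero and equal to its own square. *)
Lemma alternating_bicharacter_eq (b1 b2 : 'rV['Z_2]_n -> 'rV['Z_2]_n -> F) :
  alternating_bicharacter [set: 'rV['Z_2]_n]%G b1 ->
  alternating_bicharacter [set: 'rV['Z_2]_n]%G b2 ->
  (forall i j, b1 (e i) (e j) = b2 (e i) (e j)) -> b1 =2 b2.
Proof.
move=> b1P b2P b12.
have T x : x \in [set: 'rV['Z_2]_n] by rewrite inE.
have left0 (b : 'rV['Z_2]_n -> 'rV['Z_2]_n -> F) c :
    alternating_bicharacter [set: 'rV['Z_2]_n]%G b -> b 0 c = 1.
  case=> nz l _ _; apply: (mulfI (nz _ _ (T 0) (T c))).
  by rewrite mulr1 -l ?addr0.
have right0 (b : 'rV['Z_2]_n -> 'rV['Z_2]_n -> F) c :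
    alternating_bicharacter [set: 'rV['Z_2]_n]%G b -> b c 0 = 1.
  case=> nz _ r _; apply: (mulfI (nz _ _ (T c) (T 0))).
  by rewrite mulr1 -r ?addr0.
move=> x y; elim/basis_ind: x => [|x x' IHx IHx'|i].
- by rewrite !left0.
- by case: b1P b2P => [_ l1 _ _] [_ l2 _ _]; rewrite l1 // l2 // IHx IHx'.
elim/basis_ind: y => [|y y' IHy IHy'|j //].
- by rewrite !right0.
- by case: b1P b2P => [_ _ r1 _] [_ _ r2 _]; rewrite r1 // r2 // IHy IHy'.
Qed.

Hypothesis F2 : 2 != 0 :> F.

Lemma sgn_eq1 (x : 'Z_2) : (sgn x == 1) = (x == 0).
Proof.
case: (Z2_cases x) => ->; rewrite /sgn /= ?expr0 ?expr1 ?eqxx //.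
by rewrite eq_sym -subr_eq0 opprK; apply/negbTE.
Qed.

Lemma beta_eq1 a b : (beta F a b == 1) = (pairing a b == 0).
Proof. by rewrite betaE sgn_eq1. Qed.

Lemma natrZ2 m : m%:R = (odd m)%:R :> 'Z_2.
Proof.
by rewrite -[in LHS](odd_double_half m) -addnn !natrD addZ2xx addr0.
Qed.

Lemma wt_const (x : 'Z_2) : wt (const_mx x) = x *+ odd n.
Proof.
rewrite /wt (eq_bigr (fun _ => x)) => [|i _]; last by rewrite mxE.
by rewrite sumr_const card_ord -[x]mulr1 -!mulrnAr natrZ2.
Qed.

End Pairing.

(** * Edges and the subgroup that they generate *)

Section RootSystems.

Variable n : nat.
Implicit Types (a b c : 'rV['Z_2]_n) (i j k l p q s : 'I_n).

Lemma exists_notin (t : seq 'I_n) : (size t < n)%N -> exists k, k \notin t.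
Proof.
move=> lt_t_n; apply/existsP; rewrite -negb_forall; apply/negP => /forallP t_all.
have: (#|'I_n| <= #|t|)%N by apply/subset_leq_card/subsetP => k _; apply: t_all.
by rewrite card_ord leqNgt (leq_ltn_trans (card_size t)).
Qed.

Lemma RplusP a : reflect (a = 0 \/ exists i, a = e i) (a \in Rplus n).
Proof.
apply: (iffP setU1P) => -[->|]; [by left | | by left |].
  by case/imsetP => i _ ->; right; exists i.
by case=> i ->; right; apply: imset_f.
Qed.

Lemma e_Rplus i : e i \in Rplus n.
Proof. by apply/RplusP; right; exists i. Qed.

Lemma gen_Rplus : <<Rplus n>>%g = [set: 'rV['Z_2]_n].
Proof.
apply/eqP; rewrite eqEsubset subsetT; apply/subsetP => a _.
elim/basis_ind: a => [|a b Ha Hb|i]; first exact: group1.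
  exact: groupM.
exact/mem_gen/e_Rplus.
Qed.

Lemma RminusP a :
  reflect (exists i j, i != j /\ a = e i + e j) (a \in Rminus n).
Proof.
apply: (iffP imsetP) => [[[i j]]|[i [j [ij ->]]]].
  by rewrite inE /= => ij ->; exists i, j; rewrite -val_eqE neq_ltn ij.
move: ij; rewrite -val_eqE neq_ltn => /orP[ij|ji].
  by exists (i, j); rewrite ?inE.
by exists (j, i); rewrite ?inE // addrC.
Qed.

Lemma eD_Rminus i j : i != j -> e i + e j \in Rminus n.
Proof. by move=> ij; apply/RminusP; exists i, j. Qed.

Lemma set_oppZ2v (R : {set 'rV['Z_2]_n}) : R = [set - a | a in R].
Proof.
by rewrite -[LHS]imset_id; apply: eq_imset => a; rewrite oppZ2v.
Qed.

(** An even vector is [a + wt a *: e i0] for any index [i0].  For an arbitrary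
    [a] this expression is additive in [a] and sends [e i] to the edge
    [e i + e i0] or to [0], which makes it accessible to [basis_ind]. *)
Lemma mem_G1 a : (a \in G1 n) = (wt a == 0).
Proof.
have even_group : group_set [set b : 'rV['Z_2]_n | wt b == 0].
  apply/group_setP; split=> [|b c]; first by rewrite inE wt0.
  by rewrite !inE FinRing.zmodMgE wtD => /eqP-> /eqP->; rewrite addr0.
apply/idP/eqP => [|wt_a].
  suff /subsetP sub: G1 n \subset Group even_group by move/sub; rewrite inE => /eqP.
  rewrite gen_subG; apply/subsetP => _ /RminusP[i [j [_ ->]]].
  by rewrite inE wtD !wt_e.
have [i0 | n0] := pickP 'I_n; last first.
  suff -> : a = 0 by apply: group1.
  by apply/rowP => i; have := n0 i.
move=> _; suff : a + wt a *: e i0 \in G1 n by rewrite wt_a scale0r addr0.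
elim/basis_ind: (a) => [|b c Hb Hc|i].
- by rewrite wt0 scale0r addr0 group1.
- by rewrite wtD scalerDl addrACA; apply: groupM.
rewrite wt_e scale1r; have [->|ii0] := eqVneq i i0; first by rewrite addZ2v group1.
exact/mem_gen/eD_Rminus.
Qed.

Lemma mem_eD_G1 i j : e i + e j \in G1 n.
Proof. by rewrite mem_G1 wtD !wt_e. Qed.

Lemma pairing_eDl i j a : wt a = 0 -> pairing (e i + e j) a = a 0 i + a 0 j.
Proof.
by move=> wt_a; rewrite pairingC pairingDr !pairing_er wt_a !sub0r !oppZ2.
Qed.

(** The parity of the number of common indices of two edges. *)
Lemma pairing_edges i j k l : pairing (e i + e j) (e k + e l) =
  (i == k)%:R + (i == l)%:R + (j == k)%:R + (j == l)%:R.
Proof.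
rewrite pairing_eDl ?wtD ?wt_e; last exact: val_inj.
by rewrite !mxE !eqxx addrA.
Qed.

(** Two pairs that share an even number of indices share both or none. *)
Lemma edges_commuteP i j k l : i != j -> k != l ->
  pairing (e i + e j) (e k + e l) = 0 ->
  e i + e j = e k + e l \/ uniq [:: i; j; k; l].
Proof.
move=> ij kl; rewrite pairing_edges /= !inE !negb_or ij kl.
have [ik|ik] := eqVneq i k.
  rewrite -ik; have [-> _|jl] := eqVneq j l; first by left.
  by rewrite (eq_sym j) (negPf ij) ik (negPf kl).
have [il|il] := eqVneq i l.
  rewrite -il; have [-> _|jk] := eqVneq j k; first by left; rewrite addrC.
  by rewrite (eq_sym j) (negPf ij).
have [jk|jk] := eqVneq j k; first by rewrite jk (negPf kl).
by case: (j == l) => // _; right.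
Qed.

(** Edges that share exactly one index, renamed so that the shared one is the end
    of the first and the origin of the second: closure of [Rminus n] and the
    bracket of basis vectors are then single computations. *)
Lemma edges_anticommuteP a b : a \in Rminus n -> b \in Rminus n ->
  pairing a b != 0 ->
  exists p q s, [/\ uniq [:: p; q; s], a = e p + e q & b = e q + e s].
Proof.
have meet p q s : p != q -> q != s ->
    pairing (e p + e q) (e q + e s) != 0 ->
    exists p' q' s', [/\ uniq [:: p'; q'; s'],
      e p + e q = e p' + e q' & e q + e s = e q' + e s' :> 'rV['Z_2]_n].
  move=> pq qs; rewrite pairing_edges => nz; exists p, q, s; split=> //.
  move: nz; rewrite /= !inE (negPf pq) (negPf qs) eqxx.
  by have [_|_] := eqVneq p s.
move=> /RminusP[i [j [ij ->]]] /RminusP[k [l [kl ->]]].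
have [jk|jk] := eqVneq j k; first by rewrite -jk; apply: meet; rewrite // jk.
have [jl|jl] := eqVneq j l.
  by rewrite -jl [e k + _]addrC; apply: meet.
rewrite [e i + e j]addrC; have [ik|ik] := eqVneq i k.
  by rewrite -ik; apply: meet; [rewrite eq_sym | rewrite ik].
have [il|il] := eqVneq i l.
  by rewrite -il [e k + _]addrC; apply: meet; first rewrite eq_sym.
by rewrite pairing_edges (negPf ik) (negPf il) (negPf jk) (negPf jl) !addr0 eqxx.
Qed.

End RootSystems.

(** * The two skew root systems *)

Section Systems.

Variables (F : fieldType) (n : nat).
Hypothesis F2 : 2 != 0 :> F.
Implicit Types (a b c : 'rV['Z_2]_n) (i j k l p q s : 'I_n).

(** Pairing with [e i] reads off [wt a - a 0 i]. *)
Lemma Rad_setTP a :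
  reflect (forall i, a 0 i = wt a) (a \in Rad [set: 'rV['Z_2]_n]%G (@beta n F)).
Proof.
rewrite inE inE; apply: (iffP forall_inP) => [a_rad i | a_const b _].
  have := a_rad (e i) (in_setT _).
  by rewrite beta_eq1 // pairing_er subr_eq0 => /eqP.
rewrite beta_eq1 //; apply/eqP; elim/basis_ind: b => [|b c IHb IHc|i].
- by rewrite pairingC -(addZ2v 0) pairingDl addZ2xx.
- by rewrite pairingDr IHb IHc addr0.
by rewrite pairing_er a_const subrr.
Qed.

(** For even vectors the pairing is the usual dot product, and pairing with
    [e i + e j] compares two coordinates. *)
Lemma Rad_G1P a : reflect (wt a = 0 /\ forall i j, a 0 i = a 0 j)
  (a \in Rad (G1 n) (@beta n F)).
Proof.
rewrite inE mem_G1; apply: (iffP andP) => [[/eqP wt_a /forall_inP a_rad]|].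
  split=> // i j; have := a_rad _ (mem_eD_G1 i j).
  rewrite beta_eq1 // pairingC pairing_eDl // => /eqP/addr0_eq.
  by rewrite oppZ2.
case=> wt_a a_const; split; first exact/eqP.
apply/forall_inP => b; rewrite mem_G1 beta_eq1 // => /eqP wt_b.
rewrite /pairing wt_a mul0r sub0r oppZ2.
have [i _ | n0] := pickP 'I_n; last by rewrite big1 // => i; have := n0 i.
rewrite (eq_bigr (fun j => a 0 i * b 0 j)); last by move=> j _; rewrite (a_const i j).
by rewrite -mulr_sumr -/(wt b) wt_b mulr0.
Qed.

Lemma reduced_rad0 (G : {group 'rV['Z_2]_n}) :
  {in Rad G (@beta n F), forall a, a = 0} -> reduced G (@beta n F).
Proof.
move=> rad0; apply/eqP; rewrite eqEsubset sub1set; apply/andP; split.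
  by apply/subsetP => a /rad0->; rewrite inE.
rewrite inE group1; apply/forall_inP => b _.
by rewrite beta_eq1 // pairingC -(addZ2v 0) pairingC pairingDl addZ2xx.
Qed.

Lemma reduced_setT : (0 < n)%N ->
  reduced [set: 'rV['Z_2]_n]%G (@beta n F) <-> ~~ odd n.
Proof.
move=> n_gt0; split=> [red | even_n].
  apply/negP => odd_n.
  have: const_mx 1 \in Rad [set: 'rV['Z_2]_n]%G (@beta n F).
    by apply/Rad_setTP => i; rewrite mxE wt_const odd_n.
  rewrite red inE => /eqP/rowP/(_ (Ordinal n_gt0)).
  by rewrite !mxE.
apply: reduced_rad0 => a /Rad_setTP a_const; apply/rowP => i.
have def_a : a = const_mx (wt a) by apply/rowP => j; rewrite mxE.
by rewrite a_const mxE def_a wt_const (negPf even_n).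
Qed.

Lemma reduced_G1 : (0 < n)%N -> reduced (G1 n) (@beta n F) <-> odd n.
Proof.
move=> n_gt0; split=> [red | odd_n].
  apply/negPn/negP => even_n.
  have: const_mx 1 \in Rad (G1 n) (@beta n F).
    by apply/Rad_G1P; split=> [|i j]; rewrite ?mxE // wt_const (negPf even_n).
  rewrite red inE => /eqP/rowP/(_ (Ordinal n_gt0)).
  by rewrite !mxE.
apply: reduced_rad0 => a /Rad_G1P[wt_a a_const]; apply/rowP => i.
have def_a : a = const_mx (a 0 i) by apply/rowP => j; rewrite mxE.
by rewrite mxE -wt_a [in RHS]def_a wt_const odd_n.
Qed.

Lemma Rplus_Jordan : srs_Jordan [set: 'rV['Z_2]_n]%G (@beta n F) (Rplus n).
Proof.
split; first exact: beta_alternating.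
split.
  have R0 : 0 \in Rplus n by apply/RplusP; left.
  by move=> R_0; rewrite R_0 inE in R0.
split; [exact: gen_Rplus | exact: set_oppZ2v |].
move=> a b /RplusP[->|[i ->]] /RplusP[->|[j ->]] beta_ab; apply/RplusP.
- by left; rewrite addr0.
- by right; exists j; rewrite add0r.
- by right; exists i; rewrite addr0.
have [->|ij] := eqVneq i j; first by left; rewrite addZ2v.
by case: beta_ab; rewrite beta_ee ij expr1.
Qed.

(** The third index, outside the edge, is what prevents the edge from being a
    constant vector. *)
Lemma Rminus_not_rad a : (3 <= n)%N -> a \in Rminus n ->
  a \notin Rad (G1 n) (@beta n F).
Proof.
move=> n_ge3 /RminusP[i [j [ij ->]]]; apply/Rad_G1P => -[_ a_const].
have [k] := @exists_notin n [:: i; j] n_ge3.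
rewrite !inE negb_or => /andP[/negPf ki /negPf kj].
by have := a_const i k; rewrite !mxE !eqxx ki kj (negPf ij).
Qed.

Lemma Rminus_Lie : (3 <= n)%N -> srs_Lie (G1 n) (@beta n F) (Rminus n).
Proof.
move=> n_ge3; split; first exact: beta_alternating.
have i01 : Ordinal (ltnW (ltnW n_ge3)) != Ordinal (ltnW n_ge3) by [].
split.
  move=> radT; have /negP[] := Rminus_not_rad n_ge3 (eD_Rminus i01).
  by rewrite radT mem_eD_G1.
split=> //; last 1 first.
- move=> a b Ra Rb /eqP; rewrite beta_eq1 // => /(edges_anticommuteP Ra Rb).
  case=> p [q [s []]]; rewrite /= !inE negb_or => /andP[/andP[_ ps] _] -> ->.
  by rewrite addrA addZ2vK; apply: eD_Rminus.
- apply/subsetP => a Ra; rewrite inE Rminus_not_rad //.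
  exact: mem_gen.
exact: set_oppZ2v.
Qed.

(** From an edge one reaches first the edges that share an index with it, and
    through them every edge. *)
Lemma Rminus_connected (R : {set 'rV['Z_2]_n}) a0 :
  R \subset Rminus n -> a0 \in R ->
  {in R & Rminus n, forall a b, beta F a b != 1 -> b \in R} ->
  Rminus n \subset R.
Proof.
move=> sub Ra0 closed.
have step p q s : p != q -> s \notin [:: p; q] ->
    e p + e q \in R -> e q + e s \in R.
  rewrite !inE negb_or => pq /andP[sp sq] Rpq.
  apply: (closed _ _ Rpq); first by rewrite eD_Rminus // eq_sym.
  rewrite beta_eq1 // pairing_edges eqxx (negPf pq) (eq_sym p) (negPf sp).
  by rewrite (eq_sym q) (negPf sq).
have [i [j [ij def_a0]]] := RminusP _ (subsetP sub _ Ra0).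
move: Ra0; rewrite {a0}def_a0 => Rij.
apply/subsetP => _ /RminusP[k [l [kl ->]]].
have from_j k' l' : k' != j -> e j + e k' \in R -> l' != k' ->
    e k' + e l' \in R.
  move=> k'j Rjk l'k'; have [->|l'j] := eqVneq l' j; first by rewrite addrC.
  by apply: (step j); rewrite // 1?eq_sym // !inE negb_or l'j.
have at_j k' : k' != j -> e j + e k' \in R.
  move=> k'j; have [->|k'i] := eqVneq k' i; first by rewrite addrC.
  by apply: (step i); rewrite // !inE negb_or k'i.
have [kj|kj] := eqVneq k j; first by rewrite kj at_j // -kj eq_sym.
by apply: from_j; rewrite ?at_j // eq_sym.
Qed.

(** In a decomposition each part is closed under passing to non-commuting edges,
    so by connectedness one of them is all of [Rminus n] and its subgroup is
    not proper. *)
Lemma Rminus_indecomposable :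
  indecomposable (G1 n) (@beta n F) (Rminus n).
Proof.
case=> H1 [H2 [R1 [R2 [[prop1 prop2] _ [defR orth12] [Lie1 Lie2]]]]].
have [[_ [_ [_ gen1 _ _]]] [_ [_ [_ gen2 _ _]]]] := (Lie1, Lie2).
have [R1_0 | [a0 R1a0]] := set_0Vmem R1.
  by move: prop2; rewrite -gen2 -[R2]set0U -R1_0 -defR properxx.
suff sub: Rminus n \subset R1.
  have sub1 : G1 n \subset H1 by rewrite -gen1; apply: genS.
  by move: prop1; rewrite properE sub1 andbF.
apply: (Rminus_connected _ R1a0); first by rewrite defR subsetUl.
move=> a b R1a; rewrite defR inE => /orP[//|R2b].
by rewrite (orth12 _ _ R1a R2b) eqxx.
Qed.

End Systems.

(** A vector of even weight is determined by its coordinates other than the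
    first, which is their parity bit. *)
Lemma G1_isog n : (0 < n)%N -> (G1 n \isog [set: 'rV['Z_2]_n.-1])%g.
Proof.
case: n => // m _; rewrite isog_sym.
pose f (v : 'rV['Z_2]_m) : 'rV['Z_2]_(1 + m) := row_mx (const_mx (wt v)) v.
have fM : {in [set: 'rV['Z_2]_m] &, {morph f : u v / (u * v)%g}}.
  move=> u v _ _; rewrite /f !FinRing.zmodMgE wtD add_row_mx.
  by congr row_mx; apply/rowP => i; rewrite !mxE.
have f_inj : injective f by move=> u v; rewrite /f => /eq_row_mx[].
have wt_row (u : 'rV['Z_2]_1) (v : 'rV['Z_2]_m) :
    wt (row_mx u v : 'rV_(1 + m)) = u 0 0 + wt v.
  rewrite /wt big_split_ord big_ord1 row_mxEl.
  by congr (_ + _); apply: eq_bigr => i _; rewrite row_mxEr.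
apply/isogP; exists (Morphism fM).
  by apply/injmP => u v _ _ /f_inj.
apply/setP => a; rewrite /= mem_G1; apply/morphimP/eqP => [[v _ _ ->]|wt_a].
  by rewrite /= wt_row mxE addZ2xx.
move: wt_a; rewrite -[a](@hsubmxK _ 1 1 m); move: (lsubmx _) (rsubmx _) => u v.
rewrite wt_row => /addr0_eq; rewrite oppZ2 => u_wt.
have -> : u = const_mx (wt v) by apply/rowP => i; rewrite ord1 u_wt mxE.
by exists v; rewrite ?inE.
Qed.

(** * Isomorphisms of graded algebras *)

Section GradedAlgebras.

Variables (F : fieldType) (U : finZmodType).
Implicit Types (G : {group U}) (R : {set U}).

Definition is_bilinear (A B : vectType F) (m : A -> A -> B) : Prop :=
  (forall y, linear (m^~ y)) /\ (forall x, linear (m x)).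

Lemma linear_at0 (A B : vectType F) (f : A -> B) : linear f -> f 0 = 0.
Proof. by move=> /(_ (-1) 0 0); rewrite scaler0 addr0 scaleN1r addNr. Qed.

(** Lets bilinear identities be transferred from a spanning sequence to its span
    without choosing coordinates. *)
Lemma span_ind (A : vectType F) (X : seq A) (P : A -> Prop) :
  P 0 -> (forall k x y, x \in X -> P y -> P (k *: x + y)) ->
  forall x, x \in <<X>>%VS -> P x.
Proof.
move=> P0 Pstep x; rewrite -[X]/(val (in_tuple X)) => /coord_span ->.
by apply: big_rec => // i y _ Py; apply: Pstep => //; apply: mem_nth.
Qed.

Lemma bilinear_span_ext (A B : vectType F) (m m' : A -> A -> B) (X : seq A) :
  is_bilinear m -> is_bilinear m' -> {in X &, m =2 m'} ->
  {in <<X>>%VS &, m =2 m'}.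
Proof.
move=> [ml mr] [ml' mr'] mm' x y Xx Xy.
elim/(@span_ind _ X): x / Xx => [|k x x' Xx IHx].
  by rewrite (linear_at0 (f := m^~ y)) // (linear_at0 (f := m'^~ y)).
rewrite ml ml' IHx; congr (_ *: _ + _).
elim/(@span_ind _ X): y / Xy {x' IHx} => [|l y y' Xy IHy].
  by rewrite !linear_at0.
by rewrite mr mr' IHy mm'.
Qed.

Lemma twisted_mul_bilinear G (xi : U -> U -> F) : is_bilinear (twisted_mul G xi).
Proof.
split=> [y k x x' | x k y y']; rewrite /twisted_mul scaler_sumr -big_split;
  apply: eq_bigr => a _; rewrite scaler_sumr -big_split; apply: eq_bigr => b _;
  rewrite /= scalerA -scalerDl !ffunE; congr (_ *: _).
  by rewrite !mulrDl -!mulrA.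
by rewrite mulrDr mulrDl mulrCA -!mulrA.
Qed.

Lemma Lie_mul_bilinear G (xi : U -> U -> F) : is_bilinear (Lie_mul G xi).
Proof.
have [l r] := twisted_mul_bilinear G xi.
by split=> [y k x x' | x k y y']; rewrite /Lie_mul l r scalerBr opprD addrACA.
Qed.

Lemma Jordan_mul_bilinear G (xi : U -> U -> F) : is_bilinear (Jordan_mul G xi).
Proof.
have [l r] := twisted_mul_bilinear G xi.
split=> [y k x x' | x k y y']; rewrite /Jordan_mul l r addrACA;
by rewrite -(scalerDr k) [LHS]scalerDr !scalerA [k * _]mulrC.
Qed.

Lemma mem_basis_elt R a : a \in R -> basis_elt F a \in graded_space F R.
Proof. by move=> Ra; apply/memv_span/image_f. Qed.

Lemma graded_space_supp R x a : x \in graded_space F R -> a \notin R -> x a = 0.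
Proof.
move=> Rx Ra; elim/span_ind: x / Rx => [|k _ y /imageP[b Rb ->] y_a].
  by rewrite ffunE.
rewrite !ffunE y_a addr0; case: eqP => [ab|_]; last exact: mulr0.
by rewrite ab Rb in Ra.
Qed.

(** Reduces an isomorphism of algebras to the multiplication table of the basis
    vectors [u_a]. *)
Lemma graded_isomorphism R (B : vectType F)
    (m : {ffun U -> F^o} -> {ffun U -> F^o} -> {ffun U -> F^o})
    (m' : B -> B -> B) (phi : 'Hom({ffun U -> F^o}, B)) (T : {vspace B}) :
  is_bilinear m -> is_bilinear m' ->
  {in R &, forall a b, m (basis_elt F a) (basis_elt F b) \in graded_space F R} ->
  {in R &, forall a b, phi (m (basis_elt F a) (basis_elt F b)) =
                       m' (phi (basis_elt F a)) (phi (basis_elt F b))} ->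
  {in graded_space F R, forall x, phi x = 0 -> x = 0} ->
  (phi @: graded_space F R)%VS = T ->
  isomorphic_algebras m (graded_space F R) m' T.
Proof.
move=> [ml mr] [ml' mr'] closed phiM phi_inj <-.
have phi_m : {in graded_space F R &, forall x y, phi (m x y) = m' (phi x) (phi y)}.
  apply: bilinear_span_ext => [||_ _ /imageP[a Ra ->] /imageP[b Rb ->]].
  - by split=> [y|x] k u v /=; rewrite ?ml ?mr linearP.
  - by split=> [y|x] k u v /=; rewrite linearP ?ml' ?mr'.
  - exact: phiM.
have m_closed : closed_under m (graded_space F R).
  move=> x y Rx Ry.
  elim/span_ind: x / Rx => [|k _ x /imageP[a Ra ->] IHx].
    by rewrite (linear_at0 (f := m^~ y)) ?mem0v.
  rewrite ml memvD ?memvZ // {x IHx}.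
  elim/span_ind: y / Ry => [|l _ y /imageP[b Rb ->] IHy].
    by rewrite linear_at0 ?mem0v.
  by rewrite mr memvD ?memvZ ?closed.
split=> //.
  by move=> _ _ /memv_imgP[x Rx ->] /memv_imgP[y Ry ->];
    rewrite -phi_m // memv_img ?m_closed.
exists phi; split=> // x y Rx Ry phi_xy.
by apply/eqP; rewrite -subr_eq0; apply/eqP/phi_inj; rewrite ?memvB //
  linearB /= phi_xy subrr.
Qed.

End GradedAlgebras.

(** * The Jordan algebra of a symmetric bilinear form *)

Section FormAlgebra.

Variables (F : fieldType) (V : vectType F).

Lemma form_mul_bilinear (f : {symmetric V}) : is_bilinear (form_mul f).
Proof.
split=> [y k x x' | x k y y']; congr pair => /=.
- by rewrite linearDl /= linearZl_LR /= mulrDl addrACA -mulrA -mulrDr.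
- by rewrite scalerDl !scalerDr !scalerA (mulrC y.1) addrACA.
- by rewrite linearD /= linearZ /= mulrDr addrACA mulrCA -mulrDr.
by rewrite scalerDl !scalerDr !scalerA (mulrC x.1) addrACA.
Qed.

Lemma nondegenerate_dual (f : {symmetric V}) v : nondegenerate f -> v != 0 ->
  exists w, f v w = 1.
Proof.
move=> /eqP rad0 v_neq0.
have /mem_orthovPn[w _ fvw]: v \notin orthov f fullv by rewrite rad0 memv0.
by exists ((f v w)^-1 *: w); rewrite linearZ /= mulVf.
Qed.

Lemma orthogonal_vector (f : {symmetric V}) v : (2 <= \dim {:V})%N ->
  exists2 w, w != 0 & f v w = 0.
Proof.
move=> dimV; have := leq_dim_orthov1 f v fullv; rewrite capfv => dim_orth.
exists (vpick (orthov f <[v]>)).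
  rewrite vpick0 -dimv_eq0 -lt0n (leq_trans _ dim_orth) //.
  by rewrite -ltnS prednK // ltnW.
by apply/eqP; rewrite -mem_orthov1 mem_orthov1_sym memv_pick.
Qed.

(** Let [(a, v) <> 0] be in an ideal.  If [a = 0] then [v <> 0], and a [w] with
    [f v w = 1] gives [(0, v) (0, w) = (1, 0)].  If [a <> 0], a nonzero [w]
    orthogonal to [v], which exists in dimension at least two, gives
    [(a, v) (0, w) = (0, a *: w)], and the previous case applies. *)
Lemma form_algebra_simple (f : {symmetric V}) : nondegenerate f ->
  (2 <= \dim {:V})%N -> simple_algebra (form_mul f) fullv.
Proof.
move=> nd dimV; split=> [x y _ _|| I [_ idI]]; first exact: memvf.
  exists (1, 0), (1, 0); split; try exact: memvf.
  case; rewrite /= linear0 mulr1 addr0 => /eqP.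
  by rewrite oner_eq0.
have idIr x y : x \in I -> form_mul f x y \in I.
  by move=> Ix; have [] := idI y x (memvf y) Ix.
have unit_full : (1, 0) \in I -> I = fullv.
  move=> I1; apply/eqP; rewrite eqEsubv subvf; apply/subvP => x _.
  have -> : x = form_mul f (1, 0) x; last exact: idIr.
  by case: x => a v; congr pair; rewrite /= ?linear0l ?mul1r ?addr0 ?scale1r ?scaler0 ?addr0.
have vector_full v : v != 0 -> (0, v) \in I -> I = fullv.
  move=> /(nondegenerate_dual nd)[w fvw] Iv; apply: unit_full.
  have -> : (1, 0) = form_mul f (0, v) (0, w); last exact: idIr.
  by congr pair; rewrite /= ?fvw ?mul0r ?add0r ?scale0r ?addr0.
have [-> | I_neq0] := eqVneq I 0%VS; [by left | right].
have := memv_pick I; move: I_neq0; rewrite -vpick0.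
case: (vpick I) => a v av_neq0 Iav.
have [a0 | a_neq0] := eqVneq a 0.
  apply: (vector_full v); last by rewrite -a0.
  by apply: contraNneq av_neq0 => v0; rewrite a0 v0.
have [w w_neq0 fvw] := orthogonal_vector f v dimV.
apply: (vector_full (a *: w)); first by rewrite scaler_eq0 negb_or a_neq0.
have -> : (0, a *: w) = form_mul f (a, v) (0, w); last exact: idIr.
by congr pair; rewrite /= ?fvw ?mulr0 ?add0r ?scale0r ?addr0.
Qed.

End FormAlgebra.

Section DiagonalForm.

Variables (F : fieldType) (n : nat) (d : 'I_n -> F).
Implicit Types (u v w : 'rV[F]_n).

Definition diag_form u v : F := \sum_i d i * u 0 i * v 0 i.

Fact diag_form_sym u v : diag_form u v = (-1) ^+ false * idfun (diag_form v u).
Proof.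
by rewrite mul1r; apply: eq_bigr => i _; rewrite mulrAC.
Qed.

Fact diag_form_linear u : linear_for *%R (diag_form u).
Proof.
move=> k v w; rewrite /diag_form mulr_sumr -big_split; apply: eq_bigr => i _.
by rewrite !mxE mulrDr mulrCA.
Qed.

Fact diag_form_bilinear : bilinear_for
  (GRing.Scale.Law.clone _ _ *%R _)
  (GRing.Scale.Law.clone _ _ (idfun \; *%R) _) diag_form.
Proof.
split=> [v|u]; last exact: diag_form_linear.
by move=> k u w; rewrite 3!(diag_form_sym _ v) !mul1r; apply: diag_form_linear.
Qed.

HB.instance Definition _ := bilinear_isBilinear.Build F _ _ _
  (GRing.Scale.Law.clone _ _ *%R _)
  (GRing.Scale.Law.clone _ _ (idfun \; *%R) _) diag_form diag_form_bilinear.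

HB.instance Definition _ :=
  isHermitianSesquilinear.Build F _ false idfun diag_form diag_form_sym.

Lemma diag_form0 u : diag_form u 0 = 0.
Proof. by rewrite /diag_form big1 // => i _; rewrite mxE mulr0. Qed.

Lemma diag_formC u v : diag_form u v = diag_form v u.
Proof. by rewrite diag_form_sym mul1r. Qed.

Lemma diag_form_e u i : diag_form u (delta_mx 0 i) = d i * u 0 i.
Proof.
rewrite /diag_form (bigD1 i) //= mxE !eqxx mulr1 big1 ?addr0 // => j ji.
by rewrite mxE (negPf ji) andbF mulr0.
Qed.

Lemma diag_form_nondegenerate : (forall i, d i != 0) ->
  nondegenerate (diag_form : {symmetric 'rV[F]_n}).
Proof.
move=> d_neq0; rewrite /nondegenerate -subv0; apply/subvP => u /mem_orthovP u0.
rewrite memv0; apply/eqP/rowP => i; rewrite mxE.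
have /eqP : diag_form u (delta_mx 0 i) = 0 by apply: u0; apply: memvf.
by rewrite diag_form_e mulf_eq0 (negPf (d_neq0 i)) => /eqP.
Qed.

End DiagonalForm.

(** * The isomorphism for the Jordan system *)

Section Cocycles.

Variables (F : fieldType) (U : finZmodType) (G : {group U}).
Variables (b xi : U -> U -> F).
Hypothesis xiP : cocycle_for G b xi.

(** Cocycles are not assumed to be normalized, so [u_0] is only a multiple of the
    unit; its coefficient is the same on all basis vectors. *)
Lemma cocycle0l : {in G, forall a, xi 0 a = xi 0 0}.
Proof.
case: xiP => nz coc _ a Ga; have G0 : 0 \in G := group1 G.
apply/esym; apply: (mulIf (nz _ _ G0 Ga)).
by have := coc _ _ _ G0 G0 Ga; rewrite !add0r.
Qed.

Lemma cocycle0r : {in G, forall a, xi a 0 = xi 0 0}.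
Proof.
case: xiP => nz coc _ a Ga; have G0 : 0 \in G := group1 G.
apply: (mulfI (nz _ _ Ga G0)).
by have := coc _ _ _ Ga G0 G0; rewrite !addr0 => ->; rewrite mulrC.
Qed.

Lemma cocycle_swap : {in G &, forall a c, xi a c = b a c * xi c a}.
Proof. by case: xiP => nz _ comm a c Ga Gc; rewrite -comm // mulfVK ?nz. Qed.

Lemma Jordan_mul_basis : {in G &, forall a c,
  Jordan_mul G xi (basis_elt F a) (basis_elt F c) =
  (2^-1 * (xi a c + xi c a)) *: basis_elt F (a + c)}.
Proof.
move=> a c Ga Gc; rewrite /Jordan_mul !twisted_mul_basis // [c + a]addrC.
by rewrite -scalerDl scalerA.
Qed.

Lemma Lie_mul_basis : {in G &, forall a c,
  Lie_mul G xi (basis_elt F a) (basis_elt F c) =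
  (xi a c - xi c a) *: basis_elt F (a + c)}.
Proof.
move=> a c Ga Gc; rewrite /Lie_mul !twisted_mul_basis // [c + a]addrC.
by rewrite -scalerBl.
Qed.

End Cocycles.

Lemma scale_pairE (F : fieldType) (V : lmodType F) (k a : F) (v : V) :
  k *: ((a, v) : F^o * V) = (k * a, k *: v).
Proof. by []. Qed.

Section JordanIsomorphism.

Variables (F : fieldType) (n : nat).
Variable xi : 'rV['Z_2]_n -> 'rV['Z_2]_n -> F.

(** The value of the form on the [i]-th basis vector: [u_(e i)^2] is
    [xi (e i) (e i) *: u_0], and [u_0] is [xi 0 0] times the unit. *)
Definition square_coef (i : 'I_n) : F := xi (e i) (e i) * xi 0 0.

Definition to_form_algebra (x : {ffun 'rV['Z_2]_n -> F^o}) : F^o * 'rV[F]_n :=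
  (xi 0 0 * x 0, \row_i x (e i)).

Fact to_form_algebra_linear : linear to_form_algebra.
Proof.
move=> k x y; congr pair; first by rewrite !ffunE mulrDr mulrCA.
by apply/rowP => i; rewrite !mxE !ffunE.
Qed.

HB.instance Definition _ := GRing.isLinear.Build F _ _ _ to_form_algebra
  to_form_algebra_linear.

Lemma to_form_algebra0 : to_form_algebra (basis_elt F 0) = (xi 0 0, 0).
Proof.
congr pair; first by rewrite ffunE eqxx mulr1.
by apply/rowP => i; rewrite !mxE ffunE (negPf (e_neq0 i)).
Qed.

Lemma to_form_algebra_e i :
  to_form_algebra (basis_elt F (e i)) = (0, delta_mx 0 i).
Proof.
congr pair; first by rewrite ffunE eq_sym (negPf (e_neq0 i)) mulr0.
by apply/rowP => j; rewrite !mxE ffunE (inj_eq (@e_inj n)) eqxx.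
Qed.

Hypothesis F2 : 2 != 0 :> F.
Let G : {group 'rV['Z_2]_n} := [set: 'rV['Z_2]_n]%G.
Hypothesis xiP : cocycle_for G (@beta n F) xi.

Lemma Jordan_isomorphism :
  isomorphic_algebras (Jordan_mul G xi) (graded_space F (Rplus n))
    (form_mul (diag_form square_coef)) fullv.
Proof.
have G_ a : a \in G by rewrite inE.
have [nz coc comm] := xiP.
have half (x : F) : 2^-1 * (x + x) = x by rewrite -mulr2n -[x *+ 2]mulr_natl mulKf.
have jordan00 : Jordan_mul G xi (basis_elt F 0) (basis_elt F 0) =
    xi 0 0 *: basis_elt F 0.
  by rewrite Jordan_mul_basis // addr0 half.
have jordan0 i : Jordan_mul G xi (basis_elt F 0) (basis_elt F (e i)) =
    xi 0 0 *: basis_elt F (e i).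
  by rewrite Jordan_mul_basis // (cocycle0l xiP) // (cocycle0r xiP) // add0r half.
have jordanC x y : Jordan_mul G xi x y = Jordan_mul G xi y x.
  by rewrite /Jordan_mul addrC.
have jordan_e i j : Jordan_mul G xi (basis_elt F (e i)) (basis_elt F (e j)) =
    (if i == j then xi (e i) (e i) else 0) *: basis_elt F 0.
  rewrite Jordan_mul_basis //; have [<-|ij] := eqVneq i j.
    by rewrite addZ2v half.
  rewrite (cocycle_swap xiP (G_ (e i))) // beta_ee ij expr1 mulN1r addNr.
  by rewrite mulr0 !scale0r.
have R0 : 0 \in Rplus n by apply/RplusP; left.
apply: (@graded_isomorphism _ _ _ _ _ _ (linfun to_form_algebra)).
- exact: Jordan_mul_bilinear.
- exact: (form_mul_bilinear (diag_form square_coef)).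
- move=> a b /RplusP[->|[i ->]] /RplusP[->|[j ->]].
  + by rewrite jordan00 memvZ ?mem_basis_elt.
  + by rewrite jordan0 memvZ ?mem_basis_elt ?e_Rplus.
  + by rewrite jordanC jordan0 memvZ ?mem_basis_elt ?e_Rplus.
  + by rewrite jordan_e memvZ ?mem_basis_elt.
- have form_mulC (x y : F^o * 'rV[F]_n) :
      form_mul (diag_form square_coef) x y = form_mul (diag_form square_coef) y x.
    rewrite /form_mul diag_formC mulrC addrC [_ *: x.2 + _]addrC.
    by congr pair; rewrite addrC.
  have form0 j : form_mul (diag_form square_coef) (xi 0 0, 0) (0, delta_mx 0 j) =
      (0, xi 0 0 *: delta_mx 0 j).
    congr pair; rewrite /= ?scale0r ?addr0 //.
    by rewrite mulr0 add0r diag_formC diag_form0.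
  move=> a b /RplusP[->|[i ->]] /RplusP[->|[j ->]]; rewrite !lfunE /=.
  + rewrite jordan00 linearZ /= to_form_algebra0; congr pair => /=.
      by rewrite diag_form0 addr0.
    by rewrite !scaler0 addr0.
  + by rewrite jordan0 linearZ /= to_form_algebra0 to_form_algebra_e form0
       scale_pairE mulr0.
  + rewrite jordanC jordan0 form_mulC linearZ /= to_form_algebra0.
    by rewrite to_form_algebra_e form0 scale_pairE mulr0.
  + rewrite jordan_e linearZ /= to_form_algebra0 !to_form_algebra_e.
    rewrite scale_pairE scaler0 /form_mul /= !scale0r addr0 mul0r add0r.
    rewrite diag_form_e mxE eqxx eq_sym /square_coef /=.
    by case: eqP => [->|_]; rewrite ?mulr1 // mulr0 mul0r.
- move=> x Rx; rewrite lfunE /= => -[/eqP x0 /rowP xe]; apply/ffunP => a.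
  rewrite [RHS]ffunE; have [/RplusP[->|[i ->]]|] := boolP (a \in Rplus n).
  + by move: x0; rewrite mulf_eq0 (negPf (nz _ _ (G_ 0) (G_ 0))) => /eqP.
  + by have := xe i; rewrite !mxE.
  + exact: graded_space_supp.
apply/eqP; rewrite eqEsubv subvf; apply/subvP => -[a v] _.
have -> : (a, v) = (a / xi 0 0) *: linfun to_form_algebra (basis_elt F 0) +
    \sum_i v 0 i *: linfun to_form_algebra (basis_elt F (e i)).
  rewrite lfunE /= to_form_algebra0.
  rewrite (eq_bigr (fun i => (0, v 0 i *: delta_mx 0 i))) => [|i _]; last first.
    by rewrite lfunE /= to_form_algebra_e scale_pairE mulr0.
  rewrite scale_pairE divfK ?nz // scaler0; congr pair => /=.
    by rewrite (raddf_sum (@fst _ _)) /= big1 ?addr0.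
  rewrite (raddf_sum (@snd _ _)) /= add0r [LHS]row_sum_delta.
  by [].
rewrite memvD ?memvZ ?memv_img ?mem_basis_elt //.
by apply: memv_suml => i _; rewrite memvZ // memv_img // mem_basis_elt // e_Rplus.
Qed.

End JordanIsomorphism.

(** * Simplicity of the orthogonal Lie algebra *)

Section SpecialOrthogonal.

Variables (F : fieldType) (n : nat).
Implicit Types (A B : 'M[F]_n) (i j k l p q r s : 'I_n) (I : {vspace 'M[F]_n}).

(** The infinitesimal rotation of the plane of [i] and [j]. *)
Definition rotation_gen i j : 'M[F]_n := delta_mx i j - delta_mx j i.
Local Notation M := rotation_gen.

Lemma rotation_genC i j : M j i = - M i j.
Proof. by rewrite opprB. Qed.

Lemma rotation_gen_xx i : M i i = 0.
Proof. exact: subrr. Qed.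

Lemma rotation_gen_neq0 i j : i != j -> M i j != 0.
Proof.
move=> ij; apply/eqP => /matrixP/(_ i j); rewrite !mxE !eqxx (negPf ij) subr0.
by apply/eqP; rewrite oner_eq0.
Qed.

Lemma rotation_gen_in_so i j : M i j \in so F n.
Proof. by rewrite mem_so linearB /= !trmx_delta opprB. Qed.

Lemma so_skew A i j : A \in so F n -> A j i = - A i j.
Proof. by rewrite mem_so => /eqP/matrixP/(_ i j); rewrite !mxE. Qed.

Lemma mx_bracket_closed : closed_under (@mx_bracket F n) (so F n).
Proof.
move=> A B; rewrite !mem_so => /eqP skA /eqP skB.
by rewrite linearB /= !trmx_mul skA skB !mulmxN !mulNmx !opprK opprB.
Qed.

Lemma mx_bracket_bilinear : is_bilinear (@mx_bracket F n).
Proof.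
split=> [B k A A' | A k B B']; rewrite /mx_bracket.
  by rewrite mulmxDl mulmxDr -scalemxAl -scalemxAr opprD addrACA scalerBr.
by rewrite mulmxDl mulmxDr -scalemxAl -scalemxAr opprD addrACA scalerBr.
Qed.

Lemma mx_bracketxx A : mx_bracket A A = 0.
Proof. exact: subrr. Qed.

Lemma bracket_rotation_gen i j A k l : mx_bracket (M i j) A k l =
  (k == i)%:R * A j l - (k == j)%:R * A i l
  - ((l == j)%:R * A k i - (l == i)%:R * A k j).
Proof.
rewrite /mx_bracket mulmxBl mulmxBr.
have delta_mul p q : (delta_mx p q *m A) k l = (k == p)%:R * A q l.
  rewrite mxE (bigD1 q) //= mxE eqxx andbT big1 ?addr0 // => s /negPf sq.
  by rewrite mxE sq andbF mul0r.
have mul_delta p q : (A *m delta_mx p q) k l = (l == q)%:R * A k p.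
  rewrite mxE (bigD1 p) //= mxE eqxx mulrC big1 ?addr0 // => s /negPf sp.
  by rewrite mxE sp mulr0.
by rewrite -!delta_mul -!mul_delta !mxE.
Qed.

Lemma bracket_rotation_meet p q s : uniq [:: p; q; s] ->
  mx_bracket (M p q) (M q s) = M p s.
Proof.
rewrite /= !inE !negb_or => /andP[/andP[/negPf pq /negPf ps] /andP[/negPf qs _]].
apply/matrixP => k l; rewrite bracket_rotation_gen !mxE !eqxx pq ps qs /=.
by rewrite -!mulnb !natrM /=; ring.
Qed.

Lemma bracket_rotation_disjoint i j k l : uniq [:: i; j; k; l] ->
  mx_bracket (M i j) (M k l) = 0.
Proof.
rewrite /= !inE !negb_or => /andP[/and3P[_ /negPf ik /negPf il]].
move=> /andP[/andP[/negPf jk /negPf jl] _].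
apply/matrixP => p q; rewrite bracket_rotation_gen !mxE ik il jk jl /=.
rewrite -!mulnb !natrM /=; ring.
Qed.

Hypothesis F2 : 2 != 0 :> F.

Lemma so_diag A i : A \in so F n -> A i i = 0.
Proof.
move/(so_skew i i)/eqP; rewrite -subr_eq0 opprK -mulr2n -mulr_natl.
by rewrite mulf_eq0 (negPf F2) => /eqP.
Qed.

(** Each unordered pair of indices is counted twice, whence the factor [2^-1]. *)
Lemma so_sum A : A \in so F n -> A = 2^-1 *: \sum_i \sum_j A i j *: M i j.
Proof.
move=> soA.
have -> : \sum_i \sum_j A i j *: M i j = A - A^T.
  rewrite [A in RHS]matrix_sum_delta linear_sum -sumrB; apply: eq_bigr => i _.
  rewrite linear_sum -sumrB; apply: eq_bigr => j _.
  by rewrite linearZ /= trmx_delta scalerBr.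
move: soA; rewrite mem_so => /eqP->.
by rewrite opprK -mulr2n -scaler_nat scalerA mulVf // scale1r.
Qed.

Lemma so_span I : (forall i j, i != j -> M i j \in I) -> (so F n <= I)%VS.
Proof.
move=> IM; apply/subvP => A /so_sum->.
apply/memvZ/memv_suml => i _; apply: memv_suml => j _; apply: memvZ.
by have [->|ij] := eqVneq i j; [rewrite rotation_gen_xx mem0v | apply: IM].
Qed.

Definition separates (ij : 'I_n * 'I_n) k l :=
  (k \in [:: ij.1; ij.2]) (+) (l \in [:: ij.1; ij.2]).

(** The matrix [M i j] rotates the index [i] into [j] and kills the other
    indices, so its square acts by [-1] on positions with exactly one index in
    [{i, j}] and by [0] on positions disjoint from [{i, j}]; on [(i, j)] itself
    the bracket with [M i j] vanishes. *)
Lemma double_bracket A i j k l : A \in so F n -> i != j ->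
  mx_bracket (M i j) (mx_bracket (M i j) A) k l =
  - (if separates (i, j) k l then A k l else 0).
Proof.
move=> soA /negPf ij; have ji : (j == i) = false by rewrite eq_sym.
rewrite !bracket_rotation_gen /separates !inE /= !eqxx ij ji.
rewrite !(so_diag _ soA) (so_skew i j soA).
have [->|ki] := eqVneq k i; [|have [->|kj] := eqVneq k j];
(have [->|li] := eqVneq l i; [|have [->|lj] := eqVneq l j]);
by rewrite ?ij ?ji ?(so_diag _ soA) ?(so_skew i j soA) /=; ring.
Qed.

(** Apply the erasures of [double_bracket] for all pairs [(p, r)] and [(q, r)]
    with [r] outside [{p, q}].  Positions that meet [{p, q}] in one index are
    erased: [(p, l)] by the pair [(p, l)].  A position [(k, l)] disjoint from
    [{p, q}] survives the pair [(p, r)] only if [r] is [k] or [l], so it is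
    erased when there is a fifth index, and it does not exist when [n < 4]. *)
Lemma rotation_in_ideal I A p q : n <> 4%N -> ideal (@mx_bracket F n) (so F n) I ->
  A \in I -> A p q != 0 -> M p q \in I.
Proof.
move=> n_neq4 [/subvP I_so idI] IA Apq.
have pq : p != q by apply: contraNneq Apq => ->; rewrite so_diag ?I_so.
pose others := [seq r <- enum 'I_n | r \notin [:: p; q]].
pose pairs := [seq (p, r) | r <- others] ++ [seq (q, r) | r <- others].
have pairs_neq ij : ij \in pairs -> ij.1 != ij.2.
  rewrite mem_cat => /orP[] /mapP[r]; rewrite mem_filter !inE negb_or;
  by case/andP=> /andP[rp rq] _ ->; rewrite eq_sym.
(* [B] is what all the erasures leave of [A]. *)
have [B IB defB] : exists2 B, B \in I &
    forall k l, B k l = if all (fun ij => separates ij k l) pairs then A k l else 0.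
  elim: pairs pairs_neq => [_|[i j] t IHt neq_t]; first by exists A.
  have [|B IB defB] := IHt; first by move=> ij t_ij; apply: neq_t; rewrite inE t_ij orbT.
  have ij : i != j by apply: (neq_t (i, j)); rewrite mem_head.
  have soM := rotation_gen_in_so i j.
  exists (- mx_bracket (M i j) (mx_bracket (M i j) B)).
    by rewrite memvN; apply: (idI _ _ soM _).1; apply: (idI _ _ soM IB).1.
  move=> k l; rewrite mxE double_bracket ?I_so // opprK defB /=.
  by case: (separates _ k l).
(* For distinct [k] and [l] only positions inside [{p, q}] survive; the
   criterion is symmetric, so it is enough to place the first index. *)
have sep_pq k l : all (fun ij => separates ij k l) pairs -> k != l ->
    k \in [:: p; q].
  move=> /allP sep kl; apply: contraT => k_notin.
  have k_pairs x : x \in [:: p; q] -> separates (x, k) k l.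
    move=> x_pq; apply: sep; rewrite mem_cat; apply/orP.
    move: x_pq; rewrite !inE => /orP[] /eqP->; [left | right];
    by apply: map_f; rewrite mem_filter k_notin mem_enum.
  have lp : l != p.
    by have := k_pairs p; rewrite /separates !inE !eqxx !orbT /= negb_or => /(_ isT)/andP[].
  have lq : l != q.
    by have := k_pairs q; rewrite /separates !inE !eqxx !orbT /= negb_or => /(_ isT)/andP[].
  have uniq4 : uniq [:: p; q; k; l].
    move: k_notin; rewrite /= !inE !negb_or pq (eq_sym p k) (eq_sym q k) kl.
    by rewrite (eq_sym p l) (eq_sym q l) lp lq => /andP[-> ->].
  have n_gt4 : (4 < n)%N.
    have := max_card [in [:: p; q; k; l]]; rewrite (card_uniqP uniq4) card_ord.
    by rewrite leq_eqVlt => /orP[/eqP/esym|].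
  have [r] := exists_notin (t := [:: p; q; k; l]) n_gt4.
  rewrite !inE !negb_or => /and4P[rp rq rk rl].
  have : separates (p, r) k l.
    apply: sep; rewrite mem_cat map_f // mem_filter mem_enum !inE negb_or.
    by rewrite rp rq.
  rewrite /separates !inE (negPf lp) ![_ == r]eq_sym (negPf rk) (negPf rl).
  by move: k_notin; rewrite !inE negb_or => /andP[/negPf-> _].
have sepC k l : all (fun ij => separates ij l k) pairs =
    all (fun ij => separates ij k l) pairs.
  by apply: eq_all => ij; apply: addbC.
have sep0 : all (fun ij => separates ij p q) pairs.
  apply/allP => ij; rewrite mem_cat => /orP[] /mapP[r];
  rewrite mem_filter !inE negb_or => /andP[/andP[rp rq] _] ->;
  rewrite /separates !inE !eqxx ?(eq_sym q) ?(eq_sym p r) (negPf pq);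
  by rewrite ?(negPf rp) ?(negPf rq).
have -> : M p q = (A p q)^-1 *: B; last exact: memvZ.
apply/matrixP => k l; rewrite !mxE defB.
have [<-|kl] := eqVneq k l.
  by rewrite (so_diag _ (I_so _ IA)) if_same mulr0 andbC subrr.
case: ifP => [sep_kl | nsep].
  have := sep_pq k l sep_kl kl.
  have := sep_pq l k; rewrite sepC eq_sym => /(_ sep_kl kl).
  rewrite !inE => /orP[] /eqP ll /orP[] /eqP kk; move: kl; rewrite ll kk ?eqxx //.
    move=> _; rewrite (negPf pq) eq_sym (negPf pq) sub0r (so_skew p q (I_so _ IA)).
    by rewrite mulrN mulVf.
  by move=> _; rewrite (negPf pq) subr0 mulVf.
have -> : (k == p) && (l == q) = false.
  by apply/negP => /andP[/eqP kk /eqP ll]; rewrite kk ll sep0 in nsep.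
have -> : (k == q) && (l == p) = false.
  by apply/negP => /andP[/eqP kk /eqP ll]; rewrite kk ll sepC sep0 in nsep.
by rewrite subrr mulr0.
Qed.

(** The bracket [[M p q, M q s] = M p s] changes the second index at will, and
    [M q p = - M p q] then gives access to the first. *)
Lemma ideal_spread I p q k l : ideal (@mx_bracket F n) (so F n) I ->
  p != q -> M p q \in I -> k != l -> M k l \in I.
Proof.
move=> [_ idI].
have spread p' q' s : p' != q' -> s != p' -> M p' q' \in I -> M p' s \in I.
  move=> p'q' sp' IM; have [-> //|sq'] := eqVneq s q'.
  rewrite -(@bracket_rotation_meet p' q' s); last first.
    by rewrite /= !inE !negb_or p'q' ![_ == s]eq_sym sp' sq'.
  exact: (idI _ _ (rotation_gen_in_so q' s) IM).2.
move=> pq IM kl; have [kp|kp] := eqVneq k p.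
  by rewrite kp; apply: (spread p q); rewrite // -kp eq_sym.
apply: (spread k p) => //; first by rewrite eq_sym.
by rewrite rotation_genC memvN; apply: (spread p q).
Qed.

Lemma so_simple : (3 <= n)%N -> n <> 4%N -> simple_algebra (@mx_bracket F n) (so F n).
Proof.
move=> n_ge3 n_neq4; split; first exact: mx_bracket_closed.
  pose i0 := Ordinal (ltnW (ltnW n_ge3)); pose i1 := Ordinal (ltnW n_ge3).
  pose i2 := Ordinal n_ge3.
  exists (M i0 i1), (M i1 i2); split; try exact: rotation_gen_in_so.
  by rewrite bracket_rotation_meet //; apply/eqP/rotation_gen_neq0.
move=> I idI; have [-> | I_neq0] := eqVneq I 0%VS; [by left | right].
apply/eqP; rewrite eqEsubv idI.1 /=; apply: so_span => k l kl.
have [p [q Apq]] : exists p q, vpick I p q != 0.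
  apply/'exists_existsP; apply: contraR I_neq0.
  rewrite negb_exists => /forallP I0; rewrite -vpick0; apply/eqP/matrixP => p q.
  have := I0 p; rewrite negb_exists => /forallP/(_ q); rewrite negbK => /eqP->.
  by rewrite mxE.
have IM := rotation_in_ideal n_neq4 idI (memv_pick I) Apq.
apply: (ideal_spread idI _ IM kl); apply: contraNneq Apq => ->.
by rewrite so_diag // (subvP idI.1) ?memv_pick.
Qed.

End SpecialOrthogonal.

Lemma so2_abelian (F : fieldType) (A B : 'M[F]_2) : 2 != 0 :> F ->
  A \in so F 2 -> B \in so F 2 -> mx_bracket A B = 0.
Proof.
move=> F2 soA soB.
have ord2 (i : 'I_2) : i = ord0 \/ i = ord_max.
  by case: i => [[|[|]]] // ?; [left | right]; apply: val_inj.
have scal (C : 'M[F]_2) : C \in so F 2 ->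
    C = C ord0 ord_max *: rotation_gen F ord0 ord_max.
  move=> soC; apply/matrixP => i j; rewrite !mxE.
  have [->|->] := ord2 i; have [->|->] := ord2 j; rewrite ?(so_diag F2) //=.
  - by rewrite subrr mulr0.
  - by rewrite subr0 mulr1.
  - by rewrite (so_skew _ _ soC) sub0r mulrN1.
  - by rewrite subrr mulr0.
rewrite (scal A soA) (scal B soB) /mx_bracket.
by rewrite -!scalemxAl -!scalemxAr !scalerA mulrC subrr.
Qed.

(** * The proper ideal in dimension four *)

Section SO4.

Variable F : fieldType.
Hypothesis F2 : 2 != 0 :> F.

Let o (k : nat) : 'I_4 := inord k.
Local Notation M := (rotation_gen F).

(** The three components of [A] minus its Hodge dual: the dual exchanges
    complementary positions, with a sign for [(0, 2)] and [(1, 3)]. *)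
Definition anti_self_dual_part (A : 'M[F]_4) : F^o * F^o * F^o :=
  (A (o 0) (o 1) - A (o 2) (o 3), A (o 0) (o 2) + A (o 1) (o 3),
   A (o 0) (o 3) - A (o 1) (o 2)).

Fact anti_self_dual_part_linear : linear anti_self_dual_part.
Proof.
move=> k A B; rewrite /anti_self_dual_part !mxE.
congr (_, _, _).
- by rewrite opprD addrACA -mulrBr.
- by rewrite addrACA -mulrDr.
by rewrite opprD addrACA -mulrBr.
Qed.

HB.instance Definition _ := GRing.isLinear.Build F _ _ _ anti_self_dual_part
  anti_self_dual_part_linear.

Definition self_dual : {vspace 'M[F]_4} :=
  (so F 4 :&: lker (linfun anti_self_dual_part))%VS.

Lemma self_dualP (A : 'M[F]_4) : reflect [/\ A \in so F 4,
    A (o 2) (o 3) = A (o 0) (o 1), A (o 1) (o 3) = - A (o 0) (o 2)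
  & A (o 1) (o 2) = A (o 0) (o 3)] (A \in self_dual).
Proof.
rewrite memv_cap memv_ker lfunE /=.
apply: (iffP andP) => [[soA /eqP[A1 A2 A3]] | [soA A1 A2 A3]].
  by split=> //; [rewrite (subr0_eq A1) | rewrite (addr0_eq A2) | rewrite (subr0_eq A3)].
by split=> //; rewrite /anti_self_dual_part A1 A2 A3 !subrr.
Qed.

Lemma mul4E (A B : 'M[F]_4) i j : (A *m B) i j =
  A i (o 0) * B (o 0) j + A i (o 1) * B (o 1) j + A i (o 2) * B (o 2) j
  + A i (o 3) * B (o 3) j.
Proof.
rewrite mxE !big_ord_recl big_ord0 addr0 !addrA.
by congr (A i _ * B _ j + A i _ * B _ j + A i _ * B _ j + A i _ * B _ j);
  apply: val_inj; rewrite /= inordK.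
Qed.

Lemma mx_bracketE (A B : 'M[F]_4) i j :
  mx_bracket A B i j = (A *m B) i j - (B *m A) i j.
Proof. by rewrite !mxE. Qed.

(** One of the two factors of [so_4 = so_3 x so_3].  In coordinates the conditions
    on the bracket become polynomial identities once skew-symmetry and
    self-duality are used to eliminate the dependent entries. *)
Lemma self_dual_ideal : ideal (@mx_bracket F 4) (so F 4) self_dual.
Proof.
split; first exact: capvSl.
have main A B : A \in so F 4 -> B \in self_dual -> mx_bracket A B \in self_dual.
  move=> soA /self_dualP[soB B1 B2 B3]; apply/self_dualP.
  split; first exact: mx_bracket_closed;
    rewrite !mx_bracketE !mul4E ?(so_diag F2 _ soA) ?(so_diag F2 _ soB);
    rewrite ?(so_skew (o 0) (o 1) soA) ?(so_skew (o 0) (o 2) soA);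
    rewrite ?(so_skew (o 0) (o 3) soA) ?(so_skew (o 1) (o 2) soA);
    rewrite ?(so_skew (o 1) (o 3) soA) ?(so_skew (o 2) (o 3) soA);
    rewrite ?(so_skew (o 0) (o 1) soB) ?(so_skew (o 0) (o 2) soB);
    rewrite ?(so_skew (o 0) (o 3) soB) ?(so_skew (o 1) (o 2) soB);
    rewrite ?(so_skew (o 1) (o 3) soB) ?(so_skew (o 2) (o 3) soB);
    rewrite ?B1 ?B2 ?B3; ring.
move=> A B soA IB; split; first exact: main.
by rewrite -[mx_bracket B A]opprB memvN; apply: main.
Qed.

Lemma so4_not_simple : ~ simple_algebra (@mx_bracket F 4) (so F 4).
Proof.
have neq (j k : nat) : (j < 4)%N -> (k < 4)%N -> (o j == o k) = (j == k).
  by move=> lt_j lt_k; rewrite -val_eqE /= !inordK.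
case=> _ _ /(_ _ self_dual_ideal)[I0 | I1].
  have: M (o 0) (o 1) + M (o 2) (o 3) \in self_dual.
    apply/self_dualP; split; first by rewrite memvD ?rotation_gen_in_so.
    1-3: by rewrite !mxE !neq //= !(subr0, addr0, add0r, oppr0).
  rewrite I0 memv0 => /eqP/matrixP/(_ (o 0) (o 1)).
  rewrite !mxE !neq //= !(subr0, addr0, add0r, oppr0) => /eqP.
  by rewrite oner_eq0.
have := rotation_gen_in_so F (o 0) (o 1); rewrite -I1 => /self_dualP[_ + _ _].
rewrite !mxE !neq //= !(subr0, addr0, add0r, oppr0) => /esym/eqP.
by rewrite oner_eq0.
Qed.

End SO4.

(** * The isomorphism for the Lie system *)

Section LieIsomorphism.

Variables (F : closedFieldType) (n : nat).
Hypothesis F2 : 2 != 0 :> F.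
Variable xi : 'rV['Z_2]_n -> 'rV['Z_2]_n -> F.
Hypothesis xiP : cocycle_for (G1 n) (@beta n F) xi.
Implicit Types (i j k l p q s : 'I_n).

Local Notation ed i j := (e i + e j : 'rV['Z_2]_n).

(** In characteristic two the sum still determines its two terms, up to order,
    when they are distinct. *)
Lemma edge_eq k l p q : k != l -> p != q ->
  (ed k l == ed p q) = (k == p) && (l == q) || (k == q) && (l == p).
Proof.
move=> kl pq; apply/eqP/orP => [|[] /andP[/eqP-> /eqP->] //]; last by rewrite addrC.
move/rowP=> eq_kl_pq.
have lk : (l == k) = false by rewrite eq_sym (negPf kl).
have := eq_kl_pq k; have := eq_kl_pq l; rewrite !mxE !eqxx (negPf kl) lk /=.
have [kp|kp] := eqVneq k p.
  rewrite -kp lk ?eqxx add0r addr0.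
  by have [lq|lq] := eqVneq l q; [left | rewrite addr0].
have [kq|kq _] := eqVneq k q; last by rewrite addr0.
rewrite -kq lk addr0; have [lp _ _|//] := eqVneq l p.
by right.
Qed.

Lemma square_root (x : F) : exists y, y ^+ 2 = x.
Proof.
have /closed_rootP[y] : size ('X^2 - x%:P : {poly F}) != 1 by rewrite size_XnsubC.
by rewrite /root !hornerE subr_eq0 => /eqP; exists y.
Qed.

(** Consecutive edges share one index, so their basis vectors anticommute. *)
Lemma xi_anticomm i j k : uniq [:: i; j; k] ->
  xi (ed j k) (ed i j) = - xi (ed i j) (ed j k).
Proof.
rewrite /= !inE !negb_or => /andP[/andP[/negPf ij /negPf ik] /andP[/negPf jk _]].
rewrite (cocycle_swap xiP) ?mem_eD_G1 // betaE pairing_edges eqxx.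
by rewrite (eq_sym j i) (eq_sym k i) (eq_sym k j) ij ik jk !addr0 mulN1r.
Qed.

Lemma xi_comm a b : a \in G1 n -> b \in G1 n -> pairing a b = 0 ->
  xi a b = xi b a.
Proof.
by move=> Ga Gb ab0; rewrite (cocycle_swap xiP) // betaE ab0 mul1r.
Qed.

(** Fix [i0].  The relation for the triangle [j], [i0], [k] forces the value of
    [t j k] from [t i0 j] and [t i0 k], and then the relation for [i0], [j],
    [k] forces [(t i0 j)^2 = - 4 xi(a j, a j) xi(0, 0)], where [a j = e i0 + e j];
    this does not depend on [k] by the cocycle identity for [a j], [a j],
    [a k].  Conversely, with these choices the cocycle identities give the
    relations for all triangles. *)
Lemma structure_scalars (i0 : 'I_n) : exists t : 'I_n -> 'I_n -> F,
  [/\ forall i j, i != j -> t i j != 0, forall i j, i != j -> t j i = - t i j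
    & forall i j k, uniq [:: i; j; k] ->
        t i j * t j k = 2 * xi (ed i j) (ed j k) * t i k].
Proof.
have G_ j k : ed j k \in G1 n := mem_eD_G1 j k.
have [nz coc _] := xiP.
pose a j := ed i0 j.
have Ga j : a j \in G1 n by apply: G_.
have aD j k : a j + a k = ed j k.
  by rewrite /a [e i0 + e j]addrC addrA addZ2vK.
have aDe j k : a j + ed j k = a k by rewrite /a addrA addZ2vK.
have aa j : a j + a j = 0 by apply: addZ2v.
have /fin_all_exists[c c2] j : exists y, y ^+ 2 = - 4 * xi (a j) (a j) * xi 0 0.
  exact: square_root.
have F4 : 4 != 0 :> F by rewrite (natrM _ 2 2) mulf_neq0.
have c_neq0 j : c j != 0.
  have: c j ^+ 2 != 0 by rewrite c2 !mulf_neq0 ?oppr_eq0 ?nz ?group1.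
  by rewrite expf_eq0.
have anti j k : i0 != j -> i0 != k -> j != k -> xi (a k) (a j) = - xi (a j) (a k).
  move=> j0 k0 jk; rewrite /a [e i0 + e j]addrC xi_anticomm //.
  by rewrite /= !inE negb_or jk k0 eq_sym j0.
pose t i j := if i == i0 then c j else if j == i0 then - c i
  else - (c i * c j) / (2 * xi (a i) (a j)).
have xi_a j k : xi (a j) (a k) != 0 by rewrite nz.
exists t; split=> [i j ij | i j ij | i j k].
- rewrite /t; case: ifP => // _; case: ifP => _; first by rewrite oppr_eq0.
  by rewrite mulf_neq0 ?invr_eq0 ?oppr_eq0 ?mulf_neq0.
- rewrite /t; have [i_0|i_0] := eqVneq i i0; have [j_0|j_0] := eqVneq j i0.
  + by rewrite i_0 j_0 eqxx in ij.
  + by [].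
  + by rewrite opprK.
  rewrite (anti i j) 1?eq_sym // 1?eq_sym //.
  by have nz_ij := xi_a i j; field; rewrite F2 oppr_eq0 nz_ij.
rewrite /= !inE negb_or => /andP[/andP[ij ik] /andP[jk _]]; rewrite /t.
have [j_0|j_0] := eqVneq j i0.
  have [i_0|i_0] := eqVneq i i0; first by rewrite i_0 j_0 eqxx in ij.
  have [k_0|k_0] := eqVneq k i0; first by rewrite k_0 j_0 eqxx in jk.
  rewrite j_0 [e i + _]addrC -/(a i) -/(a k).
  by have nz_ik := xi_a i k; field; rewrite F2 nz_ik.
(* Two forms of the prescribed square, one for each side on which the third
   index of a triangle can stand. *)
have c2l x : c j ^+ 2 = - 4 * (xi (a j) (a x) * xi (a j) (ed j x)).
  have := coc _ _ _ (Ga j) (Ga j) (Ga x).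
  by rewrite aa (cocycle0l xiP) // aD => <-; rewrite c2 mulrA.
have c2r x : c j ^+ 2 = - 4 * (xi (a x) (a j) * xi (ed x j) (a j)).
  have := coc _ _ _ (Ga x) (Ga j) (Ga j).
  by rewrite aa (cocycle0r xiP) // aD => ->; rewrite c2 mulrA.
have [i_0|i_0] := eqVneq i i0.
  have [k_0|k_0] := eqVneq k i0; first by rewrite k_0 i_0 eqxx in ik.
  have nz_jk := xi_a j k; rewrite i_0 -/(a j).
  transitivity (- c j ^+ 2 * c k / (2 * xi (a j) (a k))).
    by field; rewrite F2 nz_jk.
  by rewrite (c2l k); field; rewrite F2 nz_jk.
have [k_0|k_0] := eqVneq k i0.
  have nz_ij := xi_a i j; rewrite k_0 [e j + _]addrC -/(a j).
  transitivity (c i * c j ^+ 2 / (2 * xi (a i) (a j))).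
    by field; rewrite F2 nz_ij.
  by rewrite (c2r i); field; rewrite F2 nz_ij.
(* No index is [i0]: the identity for [a i], [a j] and the edge [jk] reduces the
   relation to those of the triangles through [i0]. *)
have coc_ijk := coc _ _ _ (Ga i) (Ga j) (G_ j k); rewrite aD aDe in coc_ijk.
have [nz_ij nz_jk nz_ik] := And3 (xi_a i j) (xi_a j k) (xi_a i k).
transitivity (c i * c j ^+ 2 * c k / (4 * xi (a i) (a j) * xi (a j) (a k))).
  by field; rewrite F2 F4 nz_ij nz_jk.
have -> : xi (ed i j) (ed j k) =
    xi (a j) (ed j k) * xi (a i) (a k) / xi (a i) (a j).
  by rewrite -coc_ijk mulrC mulKf.
by rewrite (c2l k); field; rewrite ?F4 F2 nz_ij nz_jk nz_ik.
Qed.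

(** On the diagonal [e i + e i] is [0], which is not an edge, and [t i i] is
    arbitrary, so these entries are set to zero by hand. *)
Definition to_skew_mx (t : 'I_n -> 'I_n -> F)
    (x : {ffun 'rV['Z_2]_n -> F^o}) : 'M[F]_n :=
  \matrix_(i, j) (if i == j then 0 else t i j * x (e i + e j)).

Fact to_skew_mx_linear t : linear (to_skew_mx t).
Proof.
move=> k x y; apply/matrixP => i j; rewrite !mxE !ffunE.
by case: eqP => _; [rewrite mulr0 addr0 | rewrite mulrDr mulrCA].
Qed.

HB.instance Definition _ t := GRing.isLinear.Build F _ _ _ (to_skew_mx t)
  (to_skew_mx_linear t).

Lemma to_skew_mx_edge t p q : (forall i j, i != j -> t j i = - t i j) ->
  p != q ->
  to_skew_mx t (basis_elt F (ed p q)) = t p q *: rotation_gen F p q.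
Proof.
move=> t_skew pq; apply/matrixP => k l; rewrite !mxE ffunE.
have [<-|kl] := eqVneq k l; first by rewrite andbC subrr mulr0.
rewrite edge_eq //; have [kp|kp] := eqVneq k p.
  rewrite kp (negPf pq) /= orbF subr0; have [->//|_] := eqVneq l q.
  by rewrite !mulr0.
have [kq|kq] := eqVneq k q; last by rewrite subrr !mulr0.
have [lp|lp] := eqVneq l p; last by rewrite subrr !mulr0.
by rewrite kq lp t_skew // sub0r mulr1 mulrN1.
Qed.

Lemma Lie_isomorphism : (0 < n)%N ->
  isomorphic_algebras (Lie_mul (G1 n) xi) (graded_space F (Rminus n))
    (@mx_bracket F n) (so F n).
Proof.
move=> n_gt0.
have [t [t_neq0 t_skew tM]] := structure_scalars (Ordinal n_gt0).
have phi_e p q (pq : p != q) := to_skew_mx_edge t_skew pq.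
have RG a : a \in Rminus n -> a \in G1 n by apply: mem_gen.
have Lie_comm a b : a \in Rminus n -> b \in Rminus n -> pairing a b = 0 ->
    Lie_mul (G1 n) xi (basis_elt F a) (basis_elt F b) = 0.
  move=> Ra Rb ab0; rewrite Lie_mul_basis ?RG // (xi_comm _ _ ab0) ?RG //.
  by rewrite subrr scale0r.
have Lie_meet p q s : uniq [:: p; q; s] ->
    Lie_mul (G1 n) xi (basis_elt F (ed p q)) (basis_elt F (ed q s)) =
    (2 * xi (ed p q) (ed q s)) *: basis_elt F (ed p s).
  move=> pqs; rewrite Lie_mul_basis ?mem_eD_G1 // xi_anticomm // opprK.
  by rewrite -mulr2n -[_ *+ 2]mulr_natl addrA addZ2vK.
apply: (@graded_isomorphism _ _ _ _ _ _ (linfun (to_skew_mx t))).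
- exact: Lie_mul_bilinear.
- exact: mx_bracket_bilinear.
- move=> a b Ra Rb; have [ab0|/(edges_anticommuteP Ra Rb)] := eqVneq (pairing a b) 0.
    by rewrite Lie_comm ?mem0v.
  case=> p [q [s [pqs -> ->]]]; rewrite Lie_meet // memvZ // mem_basis_elt //.
  by move: pqs; rewrite /= !inE negb_or => /andP[/andP[_ ps] _]; apply: eD_Rminus.
- move=> a b Ra Rb; rewrite !lfunE /=.
  have [ab0|/(edges_anticommuteP Ra Rb)] := eqVneq (pairing a b) 0.
    rewrite Lie_comm // linear0.
    have [i [j [ij def_a]]] := RminusP _ Ra; have [k [l [kl def_b]]] := RminusP _ Rb.
    move: ab0; rewrite def_a def_b => /(edges_commuteP ij kl)[->|ijkl].
      by rewrite mx_bracketxx.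
    rewrite !phi_e // /mx_bracket -!scalemxAl -!scalemxAr !scalerA.
    by rewrite (mulrC (t k l)) -scalerBr [X in _ *: X]bracket_rotation_disjoint ?scaler0.
  case=> p [q [s [pqs -> ->]]]; rewrite Lie_meet // linearZ /=.
  have := pqs; rewrite /= !inE negb_or => /andP[/andP[pq ps] /andP[qs _]].
  rewrite !phi_e // scalerA -tM // -(bracket_rotation_meet F pqs) /mx_bracket.
  by rewrite -!scalemxAl -!scalemxAr !scalerA (mulrC (t q s)) -scalerBr.
- move=> x Rx; rewrite lfunE /= => /matrixP x0; apply/ffunP => a.
  rewrite [RHS]ffunE; have [/RminusP[i [j [ij ->]]]|] := boolP (a \in Rminus n).
    have /eqP := x0 i j; rewrite !mxE (negPf ij) mulf_eq0 (negPf (t_neq0 _ _ ij)).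
    by move/eqP.
  exact: graded_space_supp.
apply/eqP; rewrite eqEsubv; apply/andP; split.
  rewrite /graded_space limg_span; apply/span_subvP => _ /mapP[u + ->].
  move=> /imageP[_ /RminusP[p [q [pq ->]]] ->]; rewrite lfunE /= phi_e //.
  by rewrite memvZ // rotation_gen_in_so.
apply: so_span => // i j ij.
have -> : rotation_gen F i j = (t i j)^-1 *:
    linfun (to_skew_mx t) (basis_elt F (ed i j)).
  by rewrite lfunE /= phi_e // scalerA mulVf ?t_neq0 // scale1r.
by rewrite memvZ // memv_img // mem_basis_elt // eD_Rminus.
Qed.

End LieIsomorphism.

(** * The two systems and their algebras *)

Theorem proposition5p4 (F : closedFieldType) (hF : [pchar F] =i pred0)
    (n : nat) (hn : (2 <= n)%N) :
  let G : {group 'rV['Z_2]_n} := [set: 'rV['Z_2]_n]%G in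
  (* the formula is the bicharacter determined by its values on the basis *)
  (forall b : 'rV['Z_2]_n -> 'rV['Z_2]_n -> F,
     [/\ alternating_bicharacter G b,
         forall i, b (e i) (e i) = 1
       & forall i j, i != j -> b (e i) (e j) = -1]
     <-> b =2 @beta n F)
  /\
  (* (1) *)
  [/\ srs_Jordan G (@beta n F) (Rplus n),
      reduced G (@beta n F) <-> ~~ odd n
    & forall xi, cocycle_for G (@beta n F) xi ->
      exists (V : vectType F) (f : {symmetric V}),
      [/\ \dim {:V} = n, nondegenerate f,
          isomorphic_algebras (Jordan_mul G xi) (graded_space F (Rplus n))
            (form_mul f) fullv
        & simple_algebra (form_mul f) fullv]]
  /\
  (* (2) *)
  [/\ (G1 n \isog [set: 'rV['Z_2]_n.-1])%g,
      (3 <= n)%N ->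
        [/\ srs_Lie (G1 n) (@beta n F) (Rminus n),
            indecomposable (G1 n) (@beta n F) (Rminus n),
            reduced (G1 n) (@beta n F) <-> odd n
          & forall xi, cocycle_for (G1 n) (@beta n F) xi ->
            isomorphic_algebras
              (Lie_mul (G1 n) xi) (graded_space F (Rminus n))
              (@mx_bracket F n) (so F n)]
    & simple_algebra (@mx_bracket F n) (so F n) <-> (3 <= n)%N /\ n <> 4%N].
Proof.
move=> G.
have F2 : 2 != 0 :> F by have := hF 2; rewrite !inE /= => /negbT.
have n_gt0 : (0 < n)%N by apply: ltnW.
split.
  move=> b; split=> [[bP bii bij] | def_b].
    apply: (alternating_bicharacter_eq bP (beta_alternating F _)) => i j.
    rewrite beta_ee; have [->|ij] := eqVneq i j; first by rewrite bii.
    by rewrite bij.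
  have [nz l r alt] := beta_alternating F G.
  split=> [|i|i j ij]; rewrite ?def_b ?beta_ee ?eqxx ?ij //.
  split=> [x y Gx Gy|x y z Gx Gy Gz|x y z Gx Gy Gz|x Gx]; rewrite !def_b.
  - exact: nz.
  - exact: l.
  - exact: r.
  - exact: alt.
split.
  split; [exact: Rplus_Jordan | exact: reduced_setT | move=> xi xiP].
  have dimV : \dim {:'rV[F]_n} = n by rewrite dimvf dim_matrix mul1r.
  have nd : nondegenerate (diag_form (square_coef xi) : {symmetric 'rV[F]_n}).
    apply: diag_form_nondegenerate => i; case: xiP => nz _ _.
    by rewrite mulf_neq0 ?nz ?inE.
  exists 'rV[F]_n, (diag_form (square_coef xi)); split=> //.
    exact: Jordan_isomorphism.
  by apply: form_algebra_simple; rewrite ?dimV.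
split.
- exact: G1_isog.
- move=> n_ge3; split; [exact: Rminus_Lie | exact: Rminus_indecomposable | exact: reduced_G1 |].
  by move=> xi xiP; apply: Lie_isomorphism.
split=> [simple_so | [n_ge3 n_neq4]]; last exact: so_simple.
split; last by move=> n4; move: simple_so; rewrite n4; apply: so4_not_simple.
rewrite ltn_neqAle hn andbT; apply/eqP => n2; move: simple_so; rewrite -n2.
by case=> _ [A [B [soA soB nz]]] _; apply: nz; apply: so2_abelian.
Qed.
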